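(* For every integer $n\geq 2$, $\mathcal{L}_p(\mathrm{Ext}(\mathbb{R}^n))=\mathcal{L}_u(\mathrm{Ext}(\mathbb{R}^n))=\mathcal{L}(\mathrm{Ext}(\mathbb{R}^n))=\mathfrak{c}^+$. In particular, the classes $\mathrm{C}(\mathbb{R}^n)$ and $\mathrm{Ext}(\mathbb{R}^n)$ are $\mathfrak{c}$-spaceable with respect to the pointwise convergence topology $\tau_p$ but are not $\mathfrak{c}^+$-lineable.
   Context: $\mathfrak{c}=|\mathbb{R}|$ and $\kappa^+$ is the cardinal successor of $\kappa$. Work in the real vector space $\mathbb{R}^{\mathbb{R}^n}$ of all functions from $\mathbb{R}^n$ to $\mathbb{R}$, with $\tau_p$ and $\tau_u$ the topologies of pointwise and uniform convergence. For $M\subset\mathbb{R}^{\mathbb{R}^n}$: - $M$ is $\mu$-lineable if $M\cup\{0\}$ contains a vector subspace of dimension $\mu$; $M$ is $\mu$-spaceable with respect to a topology $\tau$ if $M\cup\{0\}$ contains a $\tau$-closed vector subspace of dimension $\mu$. - $\mathcal{L}(M)=\min\{\kappa\colon M\cup\{0\}\text{ contains no vector subspace of dimension }\kappa\}$; $\mathcal{L}_p(M)$ (respectively $\mathcal{L}_u(M)$) is $\min\{\kappa\colon M\cup\{0\}\text{ contains no } \tau\text{-closed vector subspace of dimension }\kappa\}$ with $\tau=\tau_p$ (respectively $\tau=\tau_u$). $\mathrm{C}(\mathbb{R}^n)$ is the class of continuous functions $\mathbb{R}^n\to\mathbb{R}$. A function $F\colon X\to\mathbb{R}$ is a connectivity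 function if the graph of $F\restriction Z$ is connected in $Z\times\mathbb{R}$ for every connected $Z\subset X$. $\mathrm{Ext}(\mathbb{R}^n)$ is the class of extendable functions, i.e. $f\colon\mathbb{R}^n\to\mathbb{R}$ for which there is a connectivity function $F\colon\mathbb{R}^n\times[0,1]\to\mathbb{R}$ with $f(x)=F(x,0)$ for every $x\in\mathbb{R}^n$.
   Formalization: L_p(M) is read as the least κ such that M∪{0} contains no τ_p-closed subspace of dimension κ or larger; literally it is at most ℵ_0 for every M, since τ_p-closed subspaces are isomorphic to some R^S and never have dimension ℵ_0. *)

(* Defs.v *)
From HB Require Import structures.
From mathcomp Require Import all_boot all_order all_algebra.
From mathcomp Require Import all_classical all_reals all_analysis.
Import Order.TTheory GRing.Theory Num.Theory numFieldNormedType.Exports.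

Set Implicit Arguments.
Unset Strict Implicit.
Unset Printing Implicit Defensive.

Local Open Scope classical_set_scope.
Local Open Scope card_scope.
Local Open Scope ring_scope.

(* A cardinal is represented by any set, in any type, having that cardinality;
   cardinals are compared with #<= and #=. *)

Definition card_succ T U (A : set T) (B : set U) : Prop :=
  ~~ (B #<= A) /\
  forall (T' : Type) (C : set T'), ~~ (C #<= A) -> B #<= C.

(* K is the minimum of the class of cardinals satisfying P *)
Definition is_card_min (P : forall T : Type, set T -> Prop)
    (T : Type) (K : set T) : Prop :=
  P T K /\ forall (T' : Type) (K' : set T'), P T' K' -> K #<= K'.

Section VectorSubspaces.
Context {R : realType} {V : lmodType R}.
Implicit Types (B W M : set V).

Definition lin_indep B : Prop :=
  forall (s : seq V) (a : V -> R), uniq s -> [set` s] `<=` B ->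
    \sum_(v <- s) a v *: v = 0 -> forall v, v \in s -> a v = 0.

Definition lin_span B : set V :=
  [set w | exists (s : seq V) (a : V -> R),
    [set` s] `<=` B /\ w = \sum_(v <- s) a v *: v].

(* Hamel dimension *)
Definition has_dim W (T : Type) (K : set T) : Prop :=
  exists B, [/\ lin_indep B, lin_span B = W & B #= K].

(* Q restricts the admissible subspaces; it is used with Q the closedness
   predicate of a topology on V *)
Definition contains_subspace (Q : set V -> Prop) M (T : Type) (K : set T) :
    Prop :=
  exists W, [/\ submod_closed [in W], Q W, has_dim W K
              & W `<=` M `|` [set 0]].

Definition lineable M (T : Type) (K : set T) : Prop :=
  contains_subspace (fun=> True) M K.

End VectorSubspaces.

Section FunctionClasses.
Variables (R : realType) (n : nat).

(* R^o is R seen as a vector space over itself *)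
Notation fct := ('rV[R]_n -> R^o).
Implicit Types (M : set fct).

Definition closed_p : set fct -> Prop := @closed {ptws 'rV[R]_n -> R}.
Definition closed_u : set fct -> Prop := @closed {uniform 'rV[R]_n -> R}.

Definition spaceable_p M (T : Type) (K : set T) : Prop :=
  contains_subspace closed_p M K.
Definition spaceable_u M (T : Type) (K : set T) : Prop :=
  contains_subspace closed_u M K.

Definition is_L M (T : Type) (K : set T) : Prop :=
  is_card_min (fun U (C : set U) => ~ lineable M C) K.

Definition is_Lu M (T : Type) (K : set T) : Prop :=
  is_card_min (fun U (C : set U) => ~ spaceable_u M C) K.

(* Here "no subspace of dimension C" has to be read as "no subspace of
   dimension C or larger". A pointwise closed subspace of R^X is linearly
   isomorphic to R^S for some S `<=` X (a maximal set of points at which the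
   evaluations are linearly independent on it), so its dimension is finite or
   at least the continuum. Asking only for dimension exactly C would thus make
   the minimum at most aleph_0 for every M. Plain subspaces of dimension C
   exist below any larger one, so for is_L the two readings agree. *)
Definition is_Lp M (T : Type) (K : set T) : Prop :=
  is_card_min (fun U (C : set U) =>
    ~ exists D : set fct, C #<= D /\ spaceable_p M D) K.

Definition continuous_fcts : set fct :=
  [set f | continuous (f : 'rV[R]_n -> R)].

(* Connectedness of the graph of F over Z in Z * Y is the same as its
   connectedness as a subset of X * Y. *)
Definition connectivity_on (X Y : topologicalType) (D : set X) (F : X -> Y) :
    Prop :=
  forall Z : set X, Z `<=` D -> connected Z ->
    connected [set (x, F x) | x in Z].

(* The values of F outside R^n * [0, 1] are irrelevant. *)
Definition extendable_fcts : set fct :=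
  [set f | exists F : 'rV[R]_n * R -> R,
    connectivity_on [set x : 'rV[R]_n * R | 0 <= x.2 <= 1] F /\
    forall x, f x = F (x, 0)].

End FunctionClasses.

Arguments continuous_fcts R n : clear implicits.
Arguments extendable_fcts R n : clear implicits.

(* Main.v *)
Require Import Defs.
From HB Require Import structures.
From mathcomp Require Import all_boot all_order all_algebra.
From mathcomp Require Import all_classical all_reals all_analysis.
From mathcomp Require wochoice.
From mathcomp Require Import ring lra.
Import Order.TTheory GRing.Theory Num.Theory numFieldNormedType.Exports.

(** Write c for the cardinality of the real numbers. The theorem follows from two
    bounds and from the existence of the successor cardinal of c.

    Upper bound: a vector space of extendable functions on R^n, n >= 2, has at
    most c elements ([card_extendable_subspace]). The restriction of a connectivity
    function on R^n * [0, 1] to the bottom is a connectivity function on R^n.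
    Such a function f is peripherally continuous ([connectivity_cell]): every point
    has arbitrarily small open neighbourhoods on the boundary of which f is close
    to its value at the point. Choose countably many such open sets, small and
    covering space, together with rationals close to f on their boundaries; this is
    a code for f, and there are only c codes. If f and g have the same code, then
    h = f - g is small on all these boundaries. In a vector space, h is a
    connectivity function too, so if h does not vanish at x, it is bounded away from
    zero on the boundary of a neighbourhood of x; in dimension at least 2 this
    boundary contains a nondegenerate continuum ([surrounding_continuum]). Such a
    continuum cannot avoid the boundaries of small sets that cover it, and so
    h = 0 ([code_inj]).

    Peripheral continuity rests on the unicoherence of R^n: the common boundary of
    a connected open set and of its connected complement is connected
    ([unicoherence]), which is proved with integer valued cocycles in place of
    liftings to the universal cover of the circle. Sets with connected boundaries
    on which f stays in a closed set J can be merged without f leaving J on the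
    boundary, because a point close to which large continua with values in J
    accumulate has its value in J ([limit_of_continua]).

    Lower bound: the functions x |-> a (floor x_0) * arch (x_0 - floor x_0) * x_1,
    for arbitrary sequences a, form a pointwise closed space of continuous, hence
    extendable functions. It contains c independent functions, so by the upper
    bound its dimension is c. All its nonzero elements are unbounded, so that
    each of its subspaces is uniformly closed; this gives uniformly closed spaces
    of every dimension up to c. *)

Set Implicit Arguments.
Unset Strict Implicit.

Local Open Scope classical_set_scope.
Local Open Scope ring_scope.

(** * Connected sets in a normed space *)

Section NormedTopology.
Variables (R : realType) (V : normedModType R).
Implicit Types (x y z a b p q : V) (A B C E G U : set V) (d r : R).

Lemma closure_normP A x :
  closure A x <-> forall d, 0 < d -> exists2 y, A y & `|x - y| < d.
Proof.
split=> [cAx d d0|Ax B /nbhs_normP[d /= d0 dB]].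
  have [y [Ay xy]] := cAx _ (nbhsx_ballx x _ d0).
  by exists y => //; move: xy; rewrite -ball_normE.
by have [y Ay xy] := Ax _ d0; exists y; split => //; apply: dB.
Qed.

Lemma open_normP A :
  open A <-> forall x, A x -> exists2 d, 0 < d & forall y, `|x - y| < d -> A y.
Proof.
rewrite openE; split=> oA x Ax.
  by have /nbhs_normP[d /= d0 dA] := oA _ Ax; exists d => // y; apply: dA.
by have [d d0 dA] := oA _ Ax; apply/nbhs_normP; exists d => // y; apply: dA.
Qed.

Lemma notclosure_norm A x : ~ closure A x ->
  exists2 d, 0 < d & forall y, A y -> d <= `|x - y|.
Proof.
move=> /(contra_not (closure_normP A x).2)/existsNP[d /not_implyP[d0 h]].
exists d => // y Ay; rewrite leNgt; apply/negP => xy; apply: h; by exists y.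
Qed.

Lemma open_closure_disjoint U A : open U -> U `&` A = set0 -> U `&` closure A = set0.
Proof.
move=> oU UA; rewrite -subset0 => x [Ux cAx].
have [y [Ay Uy]] := cAx _ (open_nbhs_nbhs (conj oU Ux)).
by have : (U `&` A) y by []; rewrite UA.
Qed.

(** Away from the boundary of [U], the sets [U] and [closure U] have the same
    trace on [A], so that this trace is clopen in [A]. *)
Lemma connected_meets_boundary A U : open U -> connected A ->
  (A `&` U) !=set0 -> ~ A `<=` U -> exists2 x, A x & (closure U `\` U) x.
Proof.
move=> oU cA AU nAU; apply: contrapT => nx; apply: nAU.
suff <- : A `&` U = A by move=> x [].
apply: cA => //; first by exists U.
exists (closure U); first exact: closed_closure.
apply/seteqP; split=> x [Ax Ux]; split=> //; first exact: subset_closure.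
by apply: contrapT => nUx; apply: nx; exists x.
Qed.

Definition seg a b := [set a + s *: (b - a) | s in `[0, 1]%classic].

Lemma seg_connected a b : connected (seg a b).
Proof.
apply: connected_continuous_connected; first exact: segment_connected.
apply: continuous_subspaceT => s.
apply: cvgD; first exact: cvg_cst.
by apply: cvgZr_tmp; exact: cvg_id.
Qed.

Lemma segl a b : seg a b a.
Proof. by exists 0; rewrite /= ?scale0r ?addr0// in_itv/= lexx ler01. Qed.

Lemma segr a b : seg a b b.
Proof. by exists 1; rewrite /= ?scale1r ?subrKC// in_itv/= lexx ler01. Qed.

Lemma seg_near a b x : seg a b x -> `|x - a| <= `|b - a| /\ `|x - b| <= `|b - a|.
Proof.
move=> [s /= ]; rewrite in_itv /= => /andP[s0 s1] <-.
have -> : a + s *: (b - a) - a = s *: (b - a) by rewrite addrAC subrr add0r.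
have -> : a + s *: (b - a) - b = - (1 - s) *: (b - a).
  by rewrite scaleNr scalerBl scale1r opprB (addrC a) -addrA (opprB b).
by rewrite !normrZ normrN ger0_norm// ger0_norm ?subr_ge0//; split;
  rewrite ler_piMl// lerBlDr lerDl.
Qed.

Lemma seg_ball a b d x : `|b - a| < d -> seg a b x -> `|a - x| < d.
Proof. by move=> bd /seg_near[+ _]; rewrite distrC => /le_lt_trans; apply. Qed.

Lemma component_open A x : open A -> open (connected_component A x).
Proof.
move=> /open_normP oA; apply/open_normP => y Cy.
have [d d0 dA] := oA _ (connected_component_sub Cy).
exists d => // z yz; apply: connected_component_trans Cy _.
exists (seg y z); last exact: segr.
split; [exact: segl| |exact: seg_connected].
by move=> w; move: yz; rewrite distrC => yz /(seg_ball yz); apply: dA.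
Qed.

(** A small ball of [A] around such a point would enlarge the component. *)
Lemma component_boundary A x y : open A ->
  (closure (connected_component A x) `\` connected_component A x) y -> ~ A y.
Proof.
move=> oA [cCy nCy] Ay; have /open_normP oCy := component_open y oA.
have [d d0 dC] := oCy _ (connected_component_refl Ay).
have [z Cz yz] := (closure_normP _ _).1 cCy _ d0.
apply: nCy; apply: connected_component_trans Cz _.
by apply: connected_component_sym; apply: dC.
Qed.

Lemma setT_connected : connected [set: V].
Proof.
have -> : [set: V] = \bigcup_(x in [set: V]) seg 0 x.
  by apply/seteqP; split=> x // _; exists x => //; exact: segr.
apply: bigcup_connected => [|x _]; last exact: seg_connected.
by exists 0 => x _; exact: segl.
Qed.

(** The steps have a uniform length, hence [S] is clopen in [A]. *)
Lemma connected_uniform_ind A p (S : set V) d : 0 < d -> connected A -> A p ->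
  S p -> (forall x y, A x -> A y -> `|x - y| < d -> S x -> S y) -> A `<=` S.
Proof.
move=> d0 cA Ap Sp step; suff <- : A `&` S = A by move=> x [].
pose N (B : set V) := \bigcup_(x in A `&` B) ball x d.
have oN B : open (N B) by apply: bigcup_open => x _; exact: ball_open.
have AN B x : A x -> N B x -> exists2 y, (A `&` B) y & `|x - y| < d.
  by move=> Ax [y ABy]; rewrite -ball_normE /= distrC => yx; exists y.
have NA B x : A x -> B x -> N B x.
  by move=> Ax Bx; exists x => //; exact: ballxx.
apply: cA; first by exists p.
  exists (N S) => //; apply/seteqP; split=> x [Ax] Sx; split=> //; first exact: NA.
  by have [y [Ay Sy] xy] := AN _ _ Ax Sx; apply: step Sy; rewrite // distrC.
exists (~` N (~` S)); first exact: open_closedC.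
apply/seteqP; split=> x [Ax] Sx; split=> //.
  by move=> /(AN _ _ Ax)[y [Ay nSy] xy]; apply: nSy; exact: step Sx.
by apply: contrapT => nSx; apply: Sx; exact: NA.
Qed.

Lemma compact_closed_dist A B : compact A -> closed B -> A `&` B = set0 ->
  exists2 d, 0 < d & forall x y, A x -> B y -> d <= `|x - y|.
Proof.
move=> cA cB AB0.
have [d d0 dAB] : \forall d \near 0^'+, A `<=` [set x | forall y, B y -> d <= `|x - y|].
  have := (compact_near_coveringP A).1 cA; apply => x Ax.
  have nBx : ~ closure B x.
    by move=> /cB Bx; have : (A `&` B) x by []; rewrite AB0.
  have [e e0 eB] := notclosure_norm nBx.
  exists (ball x (e / 2), [set t | t < e / 2]).
    split; first by apply: nbhsx_ballx; rewrite divr_gt0.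
    by apply: nbhs_right_lt; rewrite divr_gt0.
  move=> [z t] /= [+ te] y By; rewrite -ball_normE /= => xz.
  have := eB _ By; have := ler_distD z x y; lra.
exists (d / 2) => [|x y Ax By]; first by rewrite divr_gt0.
apply: (dAB (d / 2)) => //=; last by rewrite divr_gt0.
by rewrite sub0r normrN gtr0_norm; rewrite /= in d0; lra.
Qed.

End NormedTopology.

(** * Unicoherence *)

Section Cocycle.
Variables (R : realType) (V : normedModType R) (c : V -> V -> int) (d : R).
Implicit Types (x y z : V).
Hypothesis d0 : 0 < d.
Hypothesis cocycle : forall x y z, `|x - y| < d -> `|y - z| < d ->
  `|x - z| < d -> c x y + c y z = c x z.

Definition subdiv (N k : nat) x := (k%:R / N%:R) *: x.

(** A discrete line integral of the cocycle along the segment from the origin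
    to [x]. *)
Definition primitive N x : int := \sum_(k < N) c (subdiv N k x) (subdiv N k.+1 x).

Lemma cocyclexx x : c x x = 0.
Proof. by have := @cocycle x x x; rewrite subrr normr0 => /(_ d0 d0 d0); lra. Qed.

(** The subdivided segments ending at [x] and at [y] are the sides of a ladder
    whose rungs and steps are short. The cocycle relation on the two triangles
    of each cell lets the difference of the sums telescope to the last rung. *)
Lemma primitive_step N x y : `|x - y| < d / 2 -> `|x| < N%:R * (d / 2) ->
  `|y| < N%:R * (d / 2) -> primitive N y - primitive N x = c x y.
Proof.
move=> xy xN yN; have [N0|N0] := eqVneq N 0%N.
  by move: xN; rewrite N0 mul0r normr_lt0.
have NR0 : 0 < N%:R :> R by rewrite ltr0n lt0n.
have d2 (t : R) : t < d / 2 -> t < d.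
  by move=> td; apply: lt_trans td _; move: d0; lra.
have subdiv_le k : (k <= N)%N -> `|subdiv N k x - subdiv N k y| < d / 2.
  move=> kN; rewrite -scalerBr normrZ ger0_norm ?divr_ge0//.
  by apply: le_lt_trans xy; rewrite ler_piMl// ler_pdivrMr// mul1r ler_nat.
have subdivS k z : `|z| < N%:R * (d / 2) ->
    `|subdiv N k z - subdiv N k.+1 z| < d / 2.
  rewrite distrC -scalerBl normrZ -mulrBl -natrB// subSnn div1r.
  by rewrite gtr0_norm ?invr_gt0// ltr_pdivrMl.
have ladder m : (m <= N)%N ->
    \sum_(k < m) c (subdiv N k y) (subdiv N k.+1 y)
    - \sum_(k < m) c (subdiv N k x) (subdiv N k.+1 x)
    = c (subdiv N m x) (subdiv N m y).
  elim: m => [_|m IH mN].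
    by rewrite !big_ord0 subrr /subdiv mul0r !scale0r cocyclexx.
  rewrite !big_ord_recr /=; have {}IH := IH (ltnW mN).
  have xym := subdiv_le m (ltnW mN); have xyS := subdiv_le _ mN.
  have xm := subdivS m _ xN; have ym := subdivS m _ yN.
  have xmyS : `|subdiv N m x - subdiv N m.+1 y| < d.
    have := ler_distD (subdiv N m y) (subdiv N m x) (subdiv N m.+1 y); lra.
  have e1 : c (subdiv N m x) (subdiv N m y) + c (subdiv N m y) (subdiv N m.+1 y)
      = c (subdiv N m x) (subdiv N m.+1 y) by apply: cocycle => //; exact: d2.
  have e2 : c (subdiv N m x) (subdiv N m.+1 x)
      + c (subdiv N m.+1 x) (subdiv N m.+1 y)
      = c (subdiv N m x) (subdiv N m.+1 y) by apply: cocycle => //; exact: d2.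
  move: IH e1 e2; move: (\sum_(k < m) _) (\sum_(k < m) _) => *; lra.
have := ladder N (leqnn N); rewrite /primitive => ->.
by rewrite /subdiv divff ?gt_eqF// !scale1r.
Qed.

Lemma primitive_large x : exists N0 : nat, forall N : nat, (N0 <= N)%N ->
  `|x| < N%:R * (d / 2).
Proof.
have d20 : 0 < d / 2 by rewrite divr_gt0.
exists (Num.truncn (`|x| / (d / 2))).+1 => N N0.
rewrite -ltr_pdivrMr//; apply: lt_le_trans (truncnS_gt _) _.
by rewrite ler_nat.
Qed.

(** The fineness of the subdivision has to grow with the norm of the end point,
    and a connected set may be unbounded: only the values for all large [N] can
    be compared along [A]. *)
Lemma primitive_const A (u : V -> int) x y : connected A ->
  (forall x y, A x -> A y -> `|x - y| < d -> c x y = u y - u x) ->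
  A x -> A y ->
  exists N0, forall N : nat, (N0 <= N)%N -> primitive N x - u x = primitive N y - u y.
Proof.
move=> cA cu Ax Ay.
pose S y := exists N0, forall N : nat, (N0 <= N)%N ->
  primitive N x - u x = primitive N y - u y.
suff : A `<=` S by apply.
apply: (@connected_uniform_ind _ _ A x S (d / 2)) => //.
- by rewrite divr_gt0.
- by exists 0%N.
move=> y' z Ay' Az y'z [N1 h1].
have [N2 h2] := primitive_large y'; have [N3 h3] := primitive_large z.
exists (maxn N1 (maxn N2 N3)) => N; rewrite !geq_max => /and3P[/h1 {}h1 /h2 yN /h3 zN].
have := primitive_step y'z yN zN; rewrite (cu y' z)//; last by move: y'z d0; lra.
move: h1 => /=; lra.
Qed.

End Cocycle.

Section Unicoherence.
Variables (R : realType) (V : normedModType R).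
Implicit Types (U P Q : set V).

Lemma seg_crosses U (a b : V) : open U -> ~ U a -> closure U b ->
  exists2 x, seg a b x & (closure U `\` U) x.
Proof.
move=> oU nUa Ub; have [Ub'|nUb] := pselect (U b); last first.
  by exists b => //; exact: segr.
apply: connected_meets_boundary => //; first exact: seg_connected.
  by exists b; split=> //; exact: segr.
by move/(_ _ (segl a b)).
Qed.

(** Unicoherence. If the boundary [C] split into closed parts [P] and [Q], count
    the signed passages between [closure U] and its complement through [Q],
    ignoring those through [P]. This is a cocycle, so it has primitives. No
    passage occurs inside [closure U], which leads from [P] to [Q]; but going
    from [P] to [Q] inside [~` U], the count is one. *)
Lemma unicoherence U : open U -> connected (closure U) -> connected (~` U) ->
  compact (closure U `\` U) -> connected (closure U `\` U).
Proof.
move=> oU cE cF compC; apply/connectedP => E [E0 EU sE].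
set C := closure U `\` U in compC EU *.
pose P := E false; pose Q := E true.
have PC : P `<=` C by rewrite EU; left.
have QC : Q `<=` C by rewrite EU; right.
have CPQ x : C x -> P x \/ Q x by rewrite EU.
have PQ0 x : P x -> Q x -> False.
  by move=> Px Qx; have : (P `&` Q) x by []; rewrite (separated_disjoint sE).
have clC : closed C.
  rewrite /C setDE; apply: closedI; first exact: closed_closure.
  exact: open_closedC.
have clP : closed P.
  move=> x cPx; have /CPQ[//|Qx] : C x by apply: clC; apply: closureS cPx.
  by have : (closure P `&` Q) x by []; rewrite sE.1.
have clQ : closed Q.
  move=> x cQx; have /CPQ[Px|//] : C x by apply: clC; apply: closureS cQx.
  by have : (P `&` closure Q) x by []; rewrite sE.2.
have [D D0 PQD] : exists2 d, 0 < d & forall x y, P x -> Q y -> d <= `|x - y|.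
  apply: compact_closed_dist => //; last exact: (separated_disjoint sE).
  exact: (subclosed_compact clP compC).
have [p Pp] := E0 false; have [q Qq] := E0 true; rewrite -/P in Pp; rewrite -/Q in Qq.
(* Jumps shorter than [d] across [C] happen within [d] of [C], and [nearQ] allows
   [2 * d]: a triangle with such a side stays within [5 * d] of that place. *)
pose d := D / 5; have d0 : 0 < d by rewrite divr_gt0.
have PQd x y : P x -> Q y -> 5 * d <= `|x - y|.
  by move=> Px Qy; rewrite /d mulrC divfK//; exact: PQD.
pose e x : int := `[< closure U x >]%:R.
pose nearQ x := exists2 y, Q y & `|x - y| < 2 * d.
pose c x y : int := (e y - e x) * `[< nearQ x >]%:R.
have eE x : closure U x -> e x = 1 by move=> ?; rewrite /e asboolT.
have eN x : ~ closure U x -> e x = 0 by move=> ?; rewrite /e asboolF.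
have crossC x y : ~ closure U x -> closure U y -> `|x - y| < d ->
    exists z, [/\ C z, `|x - z| < d & `|y - z| < d].
  move=> nx Uy xy; have nUx : ~ U x by move=> /subset_closure.
  have [z zs Cz] := seg_crosses oU nUx Uy; exists z.
  have [zx zy] := seg_near zs; split=> //.
    by rewrite distrC; apply: le_lt_trans zx _; rewrite distrC.
  by rewrite distrC; apply: le_lt_trans zy _; rewrite distrC.
have cocycle x y z : `|x - y| < d -> `|y - z| < d -> `|x - z| < d ->
    c x y + c y z = c x z.
  move=> xy yz xz.
  have [eyz|neyz] := eqVneq (e y) (e z).
    by rewrite /c eyz subrr mul0r addr0.
  suff nn : nearQ x <-> nearQ y by rewrite /c (propext nn); ring.
  have [w [Cw yw]] : exists w, [/\ C w, `|y - w| < d & `|z - w| < d].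
    have [Uy|nUy] := pselect (closure U y); have [Uz|nUz] := pselect (closure U z).
    - by rewrite !eE// eqxx in neyz.
    - have := crossC _ _ nUz Uy; rewrite distrC => /(_ yz)[w [? ? ?]].
      by exists w; split.
    - by have [w [? ? ?]] := crossC _ _ nUy Uz yz; exists w; split.
    - by rewrite !eN// eqxx in neyz.
  have [Pw _|Qw _] := CPQ _ Cw; last first.
    have := ler_distD y x w.
    by split=> _; exists w => //; lra.
  split=> -[v Qv].
    have := PQd _ _ Pw Qv; have := ler_distD x w v; have := ler_distD y w x.
    by rewrite (distrC w y) (distrC y x); lra.
  have := PQd _ _ Pw Qv; have := ler_distD y w v.
  by rewrite (distrC w y); lra.
have [N1 h1] : exists N0, forall N : nat, (N0 <= N)%N ->
    primitive c N p - 0 = primitive c N q - 0.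
  apply: (@primitive_const _ _ c d d0 cocycle (closure U) (fun=> 0)) => //.
  - by move=> x y Ux Uy _; rewrite /c !eE// subrr mul0r.
  - by have [] := PC _ Pp.
  - by have [] := QC _ Qq.
have [N2 h2] : exists N0, forall N : nat, (N0 <= N)%N ->
    primitive c N p - `[< Q p >]%:R = primitive c N q - `[< Q q >]%:R.
  apply: (@primitive_const _ _ c d d0 cocycle (~` U) (fun x => `[< Q x >]%:R)) => //.
  - move=> x y nUx nUy xy.
    have QnC z : ~ closure U z -> `[< Q z >] = false.
      by move=> nz; apply: asboolF => /QC[].
    have [Ux|nUx'] := pselect (closure U x); have [Uy|nUy'] := pselect (closure U y).
    + have [//|Px|Qx] := CPQ x; have [//|Py|Qy] := CPQ y; rewrite /c !eE// subrr mul0r.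
      * by rewrite (asboolF (PQ0 x Px)) (asboolF (PQ0 y Py)).
      * by exfalso; have := PQd _ _ Px Qy; lra.
      * by exfalso; have := PQd _ _ Py Qx; rewrite distrC; lra.
      * by rewrite !asboolT.
    + rewrite /c (eE x)// (eN y)// (QnC y)// !sub0r mulN1r; congr (- _%:R).
      congr (nat_of_bool _); apply: asbool_equiv_eq; split.
        have [//|Px [v Qv xv]|//] := CPQ x.
        by exfalso; have := PQd _ _ Px Qv; lra.
      by move=> Qx; exists x => //; rewrite subrr normr0 mulr_gt0.
    + rewrite /c (eN x)// (eE y)// (QnC x)// !subr0 mul1r; congr (_%:R).
      congr (nat_of_bool _); apply: asbool_equiv_eq; split.
        have [//|Py [v Qv xv]|//] := CPQ y.
        by exfalso; have := PQd _ _ Py Qv; have := ler_distD x y v; rewrite (distrC y x); lra.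
      by move=> Qy; exists y => //; apply: lt_trans xy _; rewrite ltr_pMl// ltr1n.
    + by rewrite /c !eN// !QnC// !subr0 mul0r.
  - by have [] := PC _ Pp.
  - by have [] := QC _ Qq.
have := h1 (maxn N1 N2) (leq_maxl _ _); have := h2 (maxn N1 N2) (leq_maxr _ _).
rewrite (asboolT Qq) (asboolF (PQ0 p Pp)) /=; lra.
Qed.

End Unicoherence.

(** * Peripheral continuity of connectivity functions *)

Section Peripheral.
Variables (R : realType) (V : normedModType R).
Implicit Types (x y z p q w : V) (A B C G O P Q U Z : set V) (J : set R).
Implicit Types (r d : R) (f : V -> R).

Lemma connected_between A B : A `<=` B -> B `<=` closure A -> connected A ->
  connected B.
Proof.
move=> AB BA cA; apply/connectedP => E [E0 EU sE].
have AEE : A `<=` E false `|` E true by rewrite -EU.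
have [AE|AE] := connected_subset sE AEE cA.
  have [x Ex] := E0 true.
  have cAx : closure A x by apply: BA; rewrite EU; right.
  by have : (closure (E false) `&` E true) x; [split=> //; exact: closureS cAx
    |rewrite sE.1].
have [x Ex] := E0 false.
have cAx : closure A x by apply: BA; rewrite EU; left.
by have : (E false `&` closure (E true)) x; [split=> //; exact: closureS cAx
  |rewrite sE.2].
Qed.

(** The balls around the points of [P] have half the distance to [Q] as radius,
    so that a point of [Q] with a free ball around it is not in the closure of
    their union. *)
Lemma separated_open P Q : separated P Q ->
  exists G, [/\ open G, P `<=` G & closure G `&` Q = set0].
Proof.
move=> [PQ1 PQ2].
have rad p : P p -> exists2 d, 0 < d & forall q, Q q -> d <= `|p - q|.
  move=> Pp; apply: notclosure_norm => cQp.
  by have : (P `&` closure Q) p by []; rewrite PQ2.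
pose D p d := 0 < d /\ forall q, Q q -> 2 * d <= `|p - q|.
exists (\bigcup_(pd in [set pd : V * R | P pd.1 /\ D pd.1 pd.2]) ball pd.1 pd.2).
split.
- by apply: bigcup_open => pd _; exact: ball_open.
- move=> p Pp; have [d d0 dQ] := rad p Pp.
  exists (p, d / 2); last by apply: ballxx; rewrite divr_gt0.
  split=> //=; split; first by rewrite divr_gt0.
  by move=> q Qq; rewrite mulrC divfK//; exact: dQ.
- rewrite -subset0 => q [cGq Qq].
  have nPq : ~ closure P q.
    by move=> cPq; have : (closure P `&` Q) q by []; rewrite PQ1.
  have [e e0 eP] := notclosure_norm nPq.
  have e20 : 0 < e / 2 by rewrite divr_gt0.
  have [z [[p d] /= [Pp [d0 dQ]]]] := (closure_normP _ _).1 cGq _ e20.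
  rewrite -ball_normE /= => pz qz.
  have := dQ _ Qq; have := eP _ Pp; have := ler_distD z p q.
  by rewrite (distrC z q) (distrC q p); lra.
Qed.

(** The form in which connectivity is used: the hypotheses isolate [(y, f y)] in
    the graph over [Z], which is connected. *)
Lemma graph_isolated f Z y (W : set V) (J : set R) :
  connectivity_on [set: V] f -> connected Z -> Z y -> open W -> W y ->
  closed J -> ~ J (f y) -> (forall z, Z z -> W z -> z <> y -> J (f z)) ->
  Z = [set y].
Proof.
move=> cf cZ Zy oW Wy cJ nJ ZJ.
have cG := cf Z (@subsetT _ _) cZ.
have eG : [set (y, f y)] = [set (x, f x) | x in Z].
  apply: cG; first by exists (y, f y).
    exists (W `*` ~` J).
      rewrite openE => -[a b] [Wa nJb]; exists (W, ~` J) => //=; split.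
        exact: open_nbhs_nbhs.
      by apply: open_nbhs_nbhs; split=> //; exact: closed_openC.
    apply/seteqP; split=> [_ ->|[_ _] /= [[z Zz [<- <-]] [Wz nJz]]].
      by split; [exists y|split].
    by have [->//|/eqP zy] := eqVneq z y; case: nJz; exact: ZJ.
  exists [set (y, f y)].
    by apply: accessible_closed_set1; apply: hausdorff_accessible;
      exact: norm_hausdorff.
  by apply/seteqP; split=> [_ ->|_ [_ ->]//]; split=> //; exists y.
apply/seteqP; split=> [z Zz|_ ->//].
by have : [set (x, f x) | x in Z] (z, f z) by [exists z]; rewrite -eG => -[].
Qed.

(** In [R^n] the first of these properties is where the dimension [n >= 2]
    enters. *)
Hypothesis outside_connected : forall y r, connected [set z | r < `|z - y|].
Hypothesis bounded_compact : forall A y r, closed A ->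
  (forall z, A z -> `|z - y| <= r) -> compact A.
Variable u : V.
Hypothesis u0 : u != 0.

Lemma far_along y a v r : v != 0 -> exists2 t, 0 < t & r < `|a + t *: v - y|.
Proof.
move=> v0; have nv : 0 < `|v| by rewrite normr_gt0.
pose t := (`|r| + `|a - y| + 1) / `|v|.
have t0 : 0 < t by rewrite divr_gt0// ltr_wpDl// addr_ge0.
exists t => //; rewrite addrAC addrC.
have := lerB_normD (t *: v) (a - y); rewrite normrZ gtr0_norm// /t divfK ?gt_eqF//.
by have := ler_norm r; lra.
Qed.

Lemma ray_crosses U y r a v : open U -> (forall z, r < `|z - y| -> U z) ->
  ~ U a -> v != 0 -> exists2 s, 0 <= s & (closure U `\` U) (a + s *: v).
Proof.
move=> oU Ufar nUa v0; have [t t0 /Ufar Ut] := far_along y a r v0.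
have [x [s /=]] := seg_crosses oU nUa (subset_closure Ut).
rewrite in_itv /= addrAC subrr add0r scalerA => /andP[s0 s1] <- Cx.
by exists (s * t) => //; rewrite mulr_ge0// ltW.
Qed.

(** Fill the holes of [O]: take for [U] the unbounded component of the
    complement of [closure O]. Its complement is connected, being made of
    [closure O] and of the other components, each of which touches [closure O].
    Thus unicoherence applies to [U]. *)
Lemma outer_boundary O y r : open O -> connected O -> O !=set0 ->
  (forall z, O z -> `|z - y| <= r) ->
  exists U, [/\ open U, forall z, r < `|z - y| -> U z, forall z, O z -> ~ U z,
    closure U `\` U `<=` closure O `\` O & connected (closure U `\` U)].
Proof.
move=> oO cO O0 Or.
have cOr z : closure O z -> `|z - y| <= r.
  move=> /closure_normP Oz; rewrite leNgt; apply/negP => rz.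
  have [|w Ow zw] := Oz (`|z - y| - r); first by rewrite subr_gt0.
  by have := Or _ Ow; have := ler_distD w z y; lra.
have oX : open (~` closure O) by apply: closed_openC; exact: closed_closure.
have [t t0 far] := far_along y y r u0.
set p := y + t *: u in far.
have farX z : r < `|z - y| -> (~` closure O) z.
  by move=> rz /cOr; rewrite leNgt rz.
pose U := connected_component (~` closure O) p.
have oU : open U by exact: component_open.
have Ufar z : r < `|z - y| -> U z.
  by move=> rz; exists [set z | r < `|z - y|].
have UO z : U z -> ~ closure O z by move/connected_component_sub.
have OU z : O z -> ~ U z by move=> Oz /UO; apply; exact: subset_closure.
have bU : closure U `\` U `<=` closure O `\` O.
  move=> z zb; split; first by apply: contrapT; exact: component_boundary zb.
  move=> Oz; have UO0 : O `&` U = set0.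
    by rewrite -subset0 => w [/OU].
  have : (O `&` closure U) z by case: zb.
  by rewrite (open_closure_disjoint oO UO0).
exists U; split=> //.
apply: unicoherence => //.
- by apply: connected_closure; exact: component_connected.
- have [a Oa] := O0.
  have -> : ~` U = \bigcup_(A in [set A | [/\ connected A, A `<=` ~` U & A a]]) A.
    apply/seteqP; split=> [z nUz|z [A [_ + _]]]; last exact.
    have cOU : closure O `<=` ~` U by move=> w cOw /UO.
    have conO : connected (closure O) by exact: connected_closure.
    have [cOz|ncOz] := pselect (closure O z).
      by exists (closure O) => //; split=> //; exact: subset_closure.
    pose W := connected_component (~` closure O) z.
    have Wz : W z by exact: connected_component_refl.
    have WU0 : U `&` W = set0.
      rewrite -subset0 => w [Uw Ww]; apply: nUz.
      apply: connected_component_trans Uw _.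
      exact: connected_component_sym.
    have [w Ww] : exists w, (closure W `\` W) w.
      have oW : open W by exact: component_open.
      have [w _ bw] := connected_meets_boundary oW (@setT_connected R V)
        (ex_intro _ z (conj I Wz)) (fun h => connected_component_sub (h a I)
        (subset_closure Oa)).
      by exists w.
    exists (closure O `|` closure W); last by right; exact: subset_closure.
    split.
    + apply: connectedU => //; last first.
        by apply: connected_closure; exact: component_connected.
      exists w; split; last by case: Ww.
      by apply: contrapT; apply: component_boundary Ww.
    + move=> v [/cOU//|cWv] Uv.
      have : (U `&` closure W) v by [].
      by rewrite (open_closure_disjoint oU WU0).
    + by left; exact: subset_closure.
  apply: bigcup_connected; first by exists a => A [].
  by move=> A [].
- apply: (bounded_compact (y := y) (r := r)).
    rewrite setDE; apply: closedI; first exact: closed_closure.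
    exact: open_closedC.
  by move=> z /bU[/cOr].
Qed.

(** If continua on which [f] takes values in the closed set [J] come arbitrarily
    close to [q] and all leave a fixed ball around [q], their union with [q] and
    with the outside of this ball is connected; were [f q] not in [J], then [q]
    would give an isolated point of the graph over this union. *)
Lemma limit_of_continua f J q d : connectivity_on [set: V] f -> closed J ->
  0 < d ->
  (forall e, 0 < e -> exists C, [/\ connected C, forall z, C z -> J (f z),
     exists2 z, C z & `|z - q| < e & exists2 z, C z & d < `|z - q|]) ->
  J (f q).
Proof.
move=> cf cJ d0 near; apply: contrapT => nJ.
pose D := [set z | d < `|z - q|].
pose K := [set C | [/\ connected C, forall z, C z -> J (f z) & (D `&` C) !=set0]].
pose M := \bigcup_(C in K) (D `|` C).
have [c [C [cC CJ CD Cc]]] : exists c C, [/\ connected C,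
    forall z, C z -> J (f z), (D `&` C) !=set0 & D c].
  have [C [cC CJ _ [c Cc cq]]] := near 1 ltr01.
  by exists c, C; split=> //; exists c.
have cM : connected M.
  apply: bigcup_connected => [|B [cB _ DB]]; first by exists c => B _; left.
  by apply: connectedU => //; exact: outside_connected.
have cZ : connected (M `|` [set q]).
  apply: connected_between cM; first by move=> z; left.
  move=> z [Mz|->]; first exact: subset_closure.
  apply/closure_normP => e e0; have [B [cB BJ [b Bb bq] [b' Bb' b'q]]] := near e e0.
  exists b; last by rewrite distrC.
  by exists B; [split=> //; exists b'|right].
have /seteqP[+ _] : M `|` [set q] = [set q].
  apply: (@graph_isolated f _ q (ball q d) J) => //.
  - by right.
  - exact: ball_open.
  - exact: ballxx.
  move=> z [[B [_ BJ _] [Dz|Bz]]|->//] + zq; last by move=> _; exact: BJ.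
  by rewrite -ball_normE /= distrC ltNge ltW.
move=> /(_ c) /=; rewrite /D /= in Cc.
move=> h; have cq : c = q by apply: h; left; exists C => //; left.
by move: Cc; rewrite cq subrr normr0 ltNge ltW.
Qed.

(** The neighbourhoods sought at [y] are the cells [O] with [O y]; the cells that
    miss [y] are useful too. *)
Definition cell f y r J O := [/\ open O, forall z, O z -> `|z - y| <= r &
  forall z, (closure O `\` O) z -> J (f z)].

Lemma cellU f y r J A B : cell f y r J A -> cell f y r J B ->
  cell f y r J (A `|` B).
Proof.
move=> [oA Ar bA] [oB Br bB]; split.
- exact: openU.
- by move=> z [/Ar|/Br].
- move=> z []; rewrite closureU => -[cz|cz] /not_orP[nA nB].
    by apply: bA.
  by apply: bB.
Qed.

Lemma cell_component f y r J A x : cell f y r J A -> A x ->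
  exists B, [/\ cell f y r J B, connected B & B x].
Proof.
move=> [oA Ar bA] Ax; exists (connected_component A x); split.
- split; first exact: component_open.
    by move=> z /connected_component_sub/Ar.
  move=> z bz; apply: bA; split; last exact: component_boundary bz.
  by case: bz => + _; apply: closureS; exact: connected_component_sub.
- exact: component_connected.
- exact: connected_component_refl.
Qed.

(** With the outer component of a cell as [U], this fills the holes of the cell. *)
Lemma filled_cell f y r J U : open U -> (forall z, r < `|z - y| -> U z) ->
  (forall z, (closure U `\` U) z -> J (f z)) -> cell f y r J (~` closure U).
Proof.
move=> oU Ufar bU; split.
- by apply: closed_openC; exact: closed_closure.
- move=> z nUz; rewrite leNgt; apply/negP => /Ufar Uz; apply: nUz.
  exact: subset_closure.
- move=> z [cz /contrapT Uz]; apply: bU; split=> // Uz'.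
  have : (U `&` closure (~` closure U)) z by [].
  rewrite open_closure_disjoint// -subset0 => w [Uw]; apply.
  exact: subset_closure.
Qed.

(** Connectivity functions are peripherally continuous. Let [O] be the union of
    the cells and suppose that [y] is not in it. Let [Z] consist of [y], of the
    outside of the ball, and of the points of the ball outside [O] at which [f]
    is not in [J]. Near [y] the other points of [Z] have values far from [f y], so
    it suffices that [Z] be connected.

    If [Z] splits, take an open set [G] around the part that avoids the outside of
    the ball, with a boundary that misses [Z], and add to it the connected cells that meet this boundary. At a boundary
    point of the result, either [f] is in [J] already, or continua in boundaries
    of filled cells reach from near this point to the boundary of [G], and
    [limit_of_continua] shows that [f] is in [J]. So the enlarged set is a cell,
    and the chosen part of [Z] lies in [O], which is absurd. *)
Lemma connectivity_cell f y r J : connectivity_on [set: V] f -> 0 < r ->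
  closed J -> nbhs (f y) J -> exists2 O, cell f y r J O & O y.
Proof.
move=> cf r0 cJ nJ; apply: contrapT => ncell.
pose cl := cell f y r J.
pose O z := exists2 A, cl A & A z.
have nOy : ~ O y by [].
pose Z z := z = y \/ (`|z - y| <= r -> ~ J (f z) /\ ~ O z).
suff cZ : connected Z.
  have [t t0 rt] := far_along y y r u0.
  have /seteqP[+ _] : Z = [set y].
    apply: (@graph_isolated f _ y (ball y r) (~` interior J)) => //.
    - by left.
    - exact: ball_open.
    - exact: ballxx.
    - exact/open_closedC/open_interior.
    move=> z [//|Zz]; rewrite -ball_normE /= distrC => /ltW/Zz[nJz _] _.
    by move=> /interior_subset.
  move=> /(_ (y + t *: u)) h; have : y + t *: u = y.
    by apply: h; right; rewrite leNgt rt.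
  move/eqP; rewrite -subr_eq0 addrAC subrr add0r scaler_eq0 (negbTE u0).
  by rewrite gt_eqF.
apply/connectedP => E [E0 EU sE].
wlog farE : E E0 EU sE / forall z, r < `|z - y| -> E true z.
  move=> wl; have farZ : [set z | r < `|z - y|] `<=` E false `|` E true.
    by rewrite -EU => z /= rz; right; rewrite leNgt rz.
  have [FE|FE] := connected_subset sE farZ (@outside_connected y r); last exact: wl.
  apply: (wl (E \o negb)) => //.
  - by move=> b; exact: E0.
  - by rewrite EU setUC.
  - by rewrite separatedC.
have [G [oG PG GQ]] := separated_open sE.
have GQ' z : closure G z -> ~ E true z.
  by move=> Gz Qz; have : (closure G `&` E true) z by []; rewrite GQ.
have cGr z : closure G z -> `|z - y| <= r.
  by move=> Gz; rewrite leNgt; apply/negP => /farE; exact: GQ'.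
have bG z : closure G z -> ~ G z -> J (f z) \/ O z.
  move=> cGz nGz; apply: contrapT => /not_orP[nJz nOz].
  have : Z z by right.
  by rewrite EU => -[/PG|/(GQ' _ cGz)].
pose K := [set A | [/\ cl A, connected A & ((closure G `\` G) `&` A) !=set0]].
pose G' := G `|` \bigcup_(A in K) A.
suff cG' : cl G'.
  have [p Pp] := E0 false.
  have Op : O p by exists G' => //; left; exact: PG.
  have Zp : Z p by rewrite EU; left.
  case: Zp => [py|Zp]; first by apply: nOy; rewrite -py.
  by have [_] := Zp (cGr _ (subset_closure (PG _ Pp))); apply.
split.
- by apply: openU => //; apply: bigcup_open => A [[]].
- move=> z [Gz|[A [[_ Ar _] _ _] /Ar//]]; exact/cGr/subset_closure.
move=> q [cG'q /not_orP[nGq nKq]].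
have [cGq|ncGq] := pselect (closure G q).
  have [//|[A cA Aq]] := bG q cGq nGq.
  have [B [cB conB Bq]] := cell_component cA Aq.
  by exfalso; apply: nKq; exists B => //; split=> //; exists q.
have [d d0 dG] : exists2 d, 0 < d & forall z, closure G z -> d <= `|q - z|.
  apply: notclosure_norm; rewrite -(closure_id (closure G)).1//.
  exact: closed_closure.
have nOq : ~ O q.
  move=> [A cA Aq]; have [B [cB conB Bq]] := cell_component cA Aq.
  have [oB _ _] := cB; have [e e0 eB] := (open_normP B).1 oB q Bq.
  have m0 : 0 < Order.min d e by rewrite lt_min d0.
  have [z G'z] := (closure_normP _ _).1 cG'q _ m0; rewrite lt_min => /andP[zd ze].
  case: G'z => [Gz|[C [cC conC [w [bw Cw]]] Cz]].
    by have := dG z (subset_closure Gz); rewrite leNgt zd.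
  apply: nKq; exists (C `|` B); last by right.
  split; first exact: cellU.
    by apply: connectedU => //; exists z; split=> //; exact: eB.
  by exists w; split=> //; left.
apply: (limit_of_continua (d := d / 2) cf cJ); first by rewrite divr_gt0.
move=> e e0.
have m0 : 0 < Order.min d e by rewrite lt_min d0.
have [z G'z] := (closure_normP _ _).1 cG'q _ m0; rewrite lt_min => /andP[zd ze].
case: G'z => [Gz|[C [cC conC [w [[cGw _] Cw]]] Cz]].
  by have := dG z (subset_closure Gz); rewrite leNgt zd.
have [oC Cr bC] := cC.
have [|U [oU Ufar CU bU cU]] := outer_boundary oC conC _ Cr; first by exists z.
have bUJ x : (closure U `\` U) x -> J (f x) by move/bU/bC.
have Uq : closure U q.
  by apply: contrapT => nUq; apply: nOq; exists (~` closure U) => //; exact: filled_cell.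
exists (closure U `\` U); split=> //.
  have [c cs Cc] := seg_crosses oU (CU _ Cz) Uq.
  by exists c => //; apply: le_lt_trans ze; have [_] := seg_near cs.
have dw := dG w cGw.
have wq0 : w - q != 0 by rewrite -normr_gt0 distrC (lt_le_trans d0).
have [s s0 Cs] := ray_crosses oU Ufar (CU _ Cw) wq0.
exists (w + s *: (w - q)) => //.
have -> : w + s *: (w - q) - q = (1 + s) *: (w - q).
  by rewrite scalerDl scale1r addrAC.
rewrite normrZ ger0_norm ?addr_ge0// (distrC w q).
have : d <= (1 + s) * `|q - w|.
  by apply: le_trans dw _; rewrite ler_peMl// lerDl.
lra.
Qed.

(** The filled boundary of a cell around [x] is met by both rays from [x]
    directed by [u] and [- u], hence is not reduced to a point. *)
Lemma surrounding_continuum (h : V -> R) x : connectivity_on [set: V] h -> h x != 0 ->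
  exists C, [/\ connected C, forall z, C z -> `|h x| / 2 <= `|h z| &
    exists a b, [/\ C a, C b & a != b]].
Proof.
move=> ch hx; pose J := [set t : R | `|h x| / 2 <= `|t|].
have nx : 0 < `|h x| by rewrite normr_gt0.
have cJ : closed J.
  have -> : J = (@Num.norm _ R^o) @^-1` [set t | `|h x| / 2 <= t] by [].
  by apply: closed_comp => [t _|]; [exact: norm_continuous|exact: closed_ge].
have nJ : nbhs (h x) J.
  apply/nbhs_normP; exists (`|h x| / 2) => /=; first by rewrite divr_gt0.
  move=> t /=; rewrite /J /=; have := lerB_dist (h x) t; lra.
have [A cA Ax] := connectivity_cell ch ltr01 cJ nJ.
have [B [[oB Br bB] conB Bx]] := cell_component cA Ax.
have [|U [oU Ufar BU bU cU]] := outer_boundary oB conB _ Br; first by exists x.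
have nu0 : - u != 0 by rewrite oppr_eq0.
have [s s0 Cs] := ray_crosses oU Ufar (BU _ Bx) u0.
have [t t0 Ct] := ray_crosses oU Ufar (BU _ Bx) nu0.
exists (closure U `\` U); split=> //; first by move=> z /bU/bB.
exists (x + s *: u), (x + t *: - u); split=> //; apply/eqP => /addrI/eqP.
rewrite scalerN -subr_eq0 opprK -scalerDl scaler_eq0 (negbTE u0) orbF.
rewrite paddr_eq0// => /andP[/eqP s00 _].
by move: Cs; rewrite s00 scale0r addr0 => /bU[_]; apply.
Qed.

End Peripheral.

(** * The cardinality of the powerset of a countable set *)

Section TernaryCode.
Variable R : realType.
Implicit Types A B : set nat.

Definition ternary_sum A n : R := \sum_(k < n) `[< A k >]%:R * 3^-1 ^+ k.

Lemma ternary_sum_homo A m n : (m <= n)%N -> ternary_sum A m <= ternary_sum A n.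
Proof.
move=> /subnK <-; elim: (n - m)%N => // j IH; apply: le_trans IH _.
by rewrite addSn /ternary_sum big_ord_recr /= lerDl mulr_ge0// exprn_ge0// invr_ge0.
Qed.

(** All the digits after the [n]th are worth half a digit at place [n]. *)
Lemma ternary_sum_gap A n m : ~ A n ->
  ternary_sum A m <= ternary_sum A n + 3^-1 ^+ n / 2.
Proof.
move=> nAn; have p0 k : 0 <= 3^-1 ^+ k :> R by rewrite exprn_ge0// invr_ge0.
have [mn|nm] := leqP m n.
  by apply: le_trans (ternary_sum_homo A mn) _; rewrite lerDl divr_ge0.
(* The remaining geometric tail makes the bound inductive. *)
suff : ternary_sum A m <= ternary_sum A n + (3^-1 ^+ n - 3^-1 ^+ m.-1) / 2.
  by have := p0 m.-1; lra.
rewrite -(subnK nm) addnS /=; elim: (m - n.+1)%N => [|j IH].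
  rewrite add0n /ternary_sum big_ord_recr /= (asboolF nAn) mul0r.
  by rewrite subrr mul0r !addr0.
rewrite addSn {1}/ternary_sum big_ord_recr /= -/(ternary_sum A _).
move: IH; rewrite [3^-1 ^+ (j + n).+1]exprS; have := p0 (j + n)%N.
by case: `[< A (j + n).+1 >] => /=; lra.
Qed.

Definition ternary A := sup (range (ternary_sum A)).

Lemma ternary_has_sup A : has_sup (range (ternary_sum A)).
Proof.
split; first by exists (ternary_sum A 0), 0%N.
exists 3 => _ [n _ <-].
suff : ternary_sum A n <= (3 - 3 * 3^-1 ^+ n) / 2.
  have : 0 <= 3^-1 ^+ n :> R by rewrite exprn_ge0// invr_ge0.
  lra.
elim: n => [|n IH]; first by rewrite /ternary_sum big_ord0 expr0; lra.
rewrite {1}/ternary_sum big_ord_recr /= -/(ternary_sum A n).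
have : 0 <= 3^-1 ^+ n :> R by rewrite exprn_ge0// invr_ge0.
by move: IH; rewrite exprS; case: `[< A n >] => /=; lra.
Qed.

Lemma ternary_lt A B n : (forall k, (k < n)%N -> A k <-> B k) -> ~ A n -> B n ->
  ternary A < ternary B.
Proof.
move=> AB nAn Bn; have p0 : 0 < 3^-1 ^+ n :> R by rewrite exprn_gt0// invr_gt0.
apply: (@le_lt_trans _ _ (ternary_sum A n + 3^-1 ^+ n / 2)).
  apply: ge_sup => [|_ [m _ <-]]; first by exists (ternary_sum A 0), 0%N.
  exact: ternary_sum_gap.
apply: (@lt_le_trans _ _ (ternary_sum B n.+1)); last first.
  apply: ub_le_sup; last by exists n.+1.
  by case: (ternary_has_sup B).
rewrite {2}/ternary_sum big_ord_recr /= (asboolT Bn) mul1r.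
have -> : ternary_sum A n = \sum_(k < n) `[< B k >]%:R * 3^-1 ^+ k.
  apply: eq_bigr => k _; congr (_%:R * _); congr nat_of_bool.
  by apply: asbool_equiv_eq; exact: AB.
by rewrite ltrD2l ltr_pdivrMr// ltr_pMr// ltr1n.
Qed.

Lemma ternary_inj : injective ternary.
Proof.
move=> A B eAB; apply: contrapT => nAB.
have ex : exists n, `[< ~ (A n <-> B n) >].
  apply: contrapT => /forallNP h; apply: nAB; apply/funext => n.
  apply: propext; apply: contrapT => nABn; apply: (h n); exact/asboolP.
case: (ex_minnP ex) => n /asboolP nABn nmin.
have below k : (k < n)%N -> A k <-> B k.
  by move=> kn; apply: contrapT => /asboolT /nmin; rewrite leqNgt kn.
have [An|nAn] := pselect (A n); have [Bn|nBn] := pselect (B n).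
- by apply: nABn.
- have := ternary_lt (fun k kn => iff_sym (below k kn)) nBn An.
  by rewrite eAB ltxx.
- by have := ternary_lt below nAn Bn; rewrite eAB ltxx.
- by apply: nABn.
Qed.

Lemma card_le_powerset_countable (T : countType) : ([set: set T] #<= [set: R])%card.
Proof.
pose F (A : set T) := ternary [set n | exists2 t, A t & pickle t = n].
have Fi : injective F.
  move=> A B /ternary_inj /seteqP[AB BA]; apply/seteqP; split=> t St.
    by have [|s Bs /(pcan_inj pickleK) <-//] := AB (pickle t); exists t.
  by have [|s As /(pcan_inj pickleK) <-//] := BA (pickle t); exists t.
have /card_eqPle[_ le] := @inj_card_eq _ _ [set: set T] F (in2W Fi).
exact: card_le_trans le (subset_card_le (@subsetT _ _)).
Qed.

End TernaryCode.

(** * Coding connectivity functions *)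

Section Coding.
Variables (R : realType) (V : normedModType R).
Hypothesis outside_connected : forall (y : V) r, connected [set z | r < `|z - y|].
Hypothesis bounded_compact : forall (A : set V) y r, closed A ->
  (forall z, A z -> `|z - y| <= r) -> compact A.
Variable u : V.
Hypothesis u0 : u != 0.
Variables (T : countType) (D : T -> V).
Hypothesis dense : forall x e, 0 < e -> exists t, `|x - D t| < e.
Implicit Types (f g : V -> R) (x y z : V) (O P : set V).

Definition inv_succ k : R := k.+1%:R^-1.

Lemma inv_succ_gt0 k : 0 < inv_succ k.
Proof. by rewrite invr_gt0 ltr0n. Qed.

Lemma inv_succ_lt e : 0 < e -> exists k, inv_succ k < e.
Proof.
move=> e0; exists (Num.truncn e^-1); rewrite /inv_succ invf_plt ?posrE//.
exact: truncnS_gt.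
Qed.

Definition rball (b : T * nat) : set V := ball (D b.1) (inv_succ b.2).

Lemma rball_basis O x : open O -> O x -> exists2 b, rball b x & rball b `<=` O.
Proof.
move=> /open_normP oO /oO[d d0 dO].
have [m md] : exists m, inv_succ m < d / 2 by apply: inv_succ_lt; rewrite divr_gt0.
have [t xt] := dense x (inv_succ_gt0 m).
exists (t, m); first by rewrite /rball -ball_normE /= distrC.
move=> z; rewrite /rball -ball_normE /= => tz; apply: dO.
by have := ler_distD (D t) x z; lra.
Qed.

Lemma open_rball_eq O P : open O -> open P ->
  (forall b, rball b `<=` O <-> rball b `<=` P) -> O = P.
Proof.
move=> oO oP OP; apply/seteqP; split=> x Sx.
  by have [b bx bO] := rball_basis oO Sx; apply: ((OP b).1 bO).
by have [b bx bP] := rball_basis oP Sx; apply: ((OP b).2 bP).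
Qed.

(** Open sets of diameter at most [inv_succ k] containing the basic ball of the
    index, with a rational that approximates [f] on their boundary. *)
Definition good f (i : nat * (T * nat)) (Oa : set V * rat) : Prop :=
  [/\ open Oa.1, rball i.2 `<=` Oa.1,
    forall x y, Oa.1 x -> Oa.1 y -> `|x - y| <= inv_succ i.1 &
    forall z, (closure Oa.1 `\` Oa.1) z -> `|f z - ratr Oa.2| <= inv_succ i.1].

Definition chosen f i : set V * rat := xget (set0, 0) [set Oa | good f i Oa].

Lemma chosenP f i : rball i.2 `<=` (chosen f i).1 -> good f i (chosen f i).
Proof.
rewrite /chosen; case: xgetP => [Oa _ //|_] /= b0.
by have : set0 (D i.2.1) by apply: b0; apply: ballxx; exact: inv_succ_gt0.
Qed.

(** A countable amount of information: the sets chosen for [f], each given by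
    the basic balls that it contains, and their rationals. *)
Definition code f : set ((nat * (T * nat)) * (T * nat + rat)) :=
  [set p | match p.2 with
           | inl b => rball b `<=` (chosen f p.1).1
           | inr a => a = (chosen f p.1).2
           end].

Lemma good_exists f x k : connectivity_on [set: V] f ->
  exists i Oa, [/\ i.1 = k, good f i Oa & rball i.2 x].
Proof.
move=> cf; have k0 := inv_succ_gt0 k.
have [a] := @rat_in_itvoo _ (f x - inv_succ k / 2) (f x + inv_succ k / 2) ltac:(lra).
rewrite in_itv /= => /andP[ax xa].
pose J := [set t : R | `|t - ratr a| <= inv_succ k].
have cJ : closed J.
  have -> : J = (fun t : R => `|t - ratr a|) @^-1` [set t | t <= inv_succ k] by [].
  apply: closed_comp => [t _|]; last exact: closed_le.
  by apply: cvg_norm; apply: cvgB; [exact: cvg_id|exact: cvg_cst].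
have nJ : nbhs (f x) J.
  apply/nbhs_normP; exists (inv_succ k / 2) => /=; first by rewrite divr_gt0.
  move=> t /=; rewrite /J /= ltr_norml ler_norml => /andP[xt tx].
  by apply/andP; split; lra.
have r0 : 0 < inv_succ k / 2 by rewrite divr_gt0.
have [A [oA Ar bA] Ax] :=
  connectivity_cell outside_connected bounded_compact u0 cf r0 cJ nJ.
have [b bx bA'] := rball_basis oA Ax.
exists (k, b), (A, a); split=> //; split=> //= y z Ay Az.
apply: le_trans (ler_distD x y z) _; rewrite (distrC x z) [leRHS]splitr.
by apply: lerD; exact: Ar.
Qed.

(** The functions [f] and [g] are both close to the same rationals on the
    boundaries of the chosen sets, so [f \- g] is small there. If it did not
    vanish at [x], it would be bounded away from zero on a continuum with two
    points; but a chosen set meeting this continuum and smaller than it has a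
    boundary point on it. *)
Lemma code_inj f g : connectivity_on [set: V] f -> connectivity_on [set: V] g ->
  connectivity_on [set: V] (f \- g) -> code f = code g -> f = g.
Proof.
move=> cf cg ch efg; apply/funext => x; apply/eqP; rewrite -subr_eq0.
apply/negPn/negP => hx.
have [C [cC Ch [a [b [Ca Cb ab]]]]] := surrounding_continuum outside_connected
  bounded_compact u0 ch hx.
have hx0 : 0 < `|(f \- g) x| by rewrite normr_gt0.
have ab0 : 0 < `|a - b| by rewrite normr_gt0 subr_eq0.
have [k] : exists k, inv_succ k < Order.min `|a - b| (`|(f \- g) x| / 4).
  by apply: inv_succ_lt; rewrite lt_min ab0 divr_gt0.
rewrite lt_min => /andP[kab khx].
have [i [Oa [ik gOa ia]]] := good_exists a k cf.
have gf : good f i (chosen f i) by apply: (xgetPex _ (P := [set Oa | good f i Oa])); exists Oa.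
have codeE p : code f p <-> code g p by rewrite efg.
have gg : good g i (chosen g i).
  by apply: chosenP; apply/(codeE (i, inl i.2)); case: gf.
have e2 : (chosen f i).2 = (chosen g i).2.
  by apply/(codeE (i, inr (chosen f i).2)).
have [oP iP dP bf] := gf; have [oQ _ _ bg] := gg.
have e1 : (chosen f i).1 = (chosen g i).1.
  by apply: open_rball_eq => // c; exact: (codeE (i, inl c)).
have [z Cz bz] : exists2 z, C z & (closure (chosen f i).1 `\` (chosen f i).1) z.
  apply: connected_meets_boundary => //; first by exists a; split=> //; exact: iP.
  by move=> CP; have := dP _ _ (CP _ Ca) (CP _ Cb); rewrite ik leNgt kab.
have fz := bf _ bz; have gz : `|g z - ratr (chosen f i).2| <= inv_succ i.1.
  by rewrite e2; apply: bg; rewrite -e1.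
move: fz gz; rewrite ik => fz gz.
have hz : `|(f \- g) z| <= inv_succ k + inv_succ k.
  apply: le_trans (ler_distD (ratr (chosen f i).2) _ _) _.
  by apply: lerD => //; rewrite distrC.
by have := Ch _ Cz; lra.
Qed.

Lemma card_connectivity_fcts (W : set (V -> R)) :
  (forall f, W f -> connectivity_on [set: V] f) ->
  (forall f g, W f -> W g -> connectivity_on [set: V] (f \- g)) ->
  (W #<= [set: R])%card.
Proof.
move=> cW cWB; have cinj : {in W &, injective code}.
  by move=> f g /set_mem Wf /set_mem Wg; apply: code_inj; [exact: cW|exact: cW|exact: cWB].
have /card_eqPle[_ le] := inj_card_eq cinj.
apply: card_le_trans le _; apply: card_le_trans (subset_card_le (@subsetT _ _)) _.
exact: card_le_powerset_countable.
Qed.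

End Coding.

(** * Extendable functions on Euclidean space *)

Lemma continuous_pair (T U W : topologicalType) (f : T -> U) (g : T -> W) :
  continuous f -> continuous g -> continuous (fun x => (f x, g x)).
Proof.
move=> cf cg x.
exact: (@cvg_pair _ _ _ (nbhs x) (nbhs (f x)) (nbhs (g x)) _ _ _ _ _ (cf x) (cg x)).
Qed.

Lemma continuous_fst (T U : topologicalType) : continuous (@fst T U).
Proof. by move=> p; exact: cvg_fst. Qed.

Lemma continuous_snd (T U : topologicalType) : continuous (@snd T U).
Proof. by move=> p; exact: cvg_snd. Qed.

Section Euclidean.
Variables (R : realType) (n : nat).
Notation V := 'rV[R]_n.
Implicit Types (x y z : V) (r : R).

Lemma rV_norm_le x r : 0 <= r -> (`|x| <= r) <-> forall i, `|x 0 i| <= r.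
Proof.
move=> r0; rewrite /Num.norm /= mx_normrE; split=> [|xr].
  by move=> /bigmax_leP[_ xr] i; exact: (xr (0, i)).
by apply/bigmax_leP; split=> // -[i j] _ /=; rewrite (ord1 i); exact: xr.
Qed.

Lemma rV_rat_dense x e : 0 < e ->
  exists t : 'rV[rat]_n, `|x - map_mx ratr t| < e.
Proof.
move=> e0; have e20 : 0 < e / 2 by rewrite divr_gt0.
have P i : exists a : rat, `|x 0 i - ratr a| <= e / 2.
  have [a] := @rat_in_itvoo _ (x 0 i - e / 2) (x 0 i + e / 2) ltac:(lra).
  rewrite in_itv /= => /andP[ax xa]; exists a.
  by rewrite ler_norml; apply/andP; split; lra.
pose t := \row_i sval (cid (P i)); exists t.
apply: (@le_lt_trans _ _ (e / 2)); last by lra.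
apply/rV_norm_le => [|i]; first exact: ltW.
by rewrite !mxE; exact: svalP (cid (P i)).
Qed.

Lemma rV_bounded_compact (A : set V) y r : closed A ->
  (forall z, A z -> `|z - y| <= r) -> compact A.
Proof.
move=> cA Ar; apply: bounded_closed_compact => //.
exists (`|y| + r); split; first exact: num_real.
move=> M yrM z /Ar zy; apply: le_trans (ltW yrM).
by have := ler_distD y z 0; rewrite !subr0; lra.
Qed.

Lemma convex_connected (A : set V) :
  (forall a b, A a -> A b -> seg a b `<=` A) -> connected A.
Proof.
move=> segA; have [[a Aa]|nA] := pselect (A !=set0); last first.
  have -> : A = set0 by rewrite -subset0 => x Ax; apply: nA; exists x.
  exact: connected0.
have -> : A = \bigcup_(x in A) seg a x.
  by apply/seteqP; split=> [x Ax|x [b Ab]]; [exists x => //; exact: segr|exact: segA].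
apply: bigcup_connected => [|x _]; last exact: seg_connected.
by exists a => x _; exact: segl.
Qed.

Hypothesis n_ge2 : (2 <= n)%N.

(** For the supremum norm this set is the union of the half-spaces bounded by
    the hyperplanes that carry the faces of the ball. Two of them which come from
    different coordinates meet, and opposite ones are joined through a third. *)
Lemma rV_outside_connected y r : connected [set z : V | r < `|z - y|].
Proof.
have [r0|r0] := ltP r 0.
  have -> : [set z | r < `|z - y|] = setT.
    by apply/seteqP; split=> // z _; exact: lt_le_trans r0 _.
  exact: setT_connected.
pose i0 : 'I_n := Ordinal (ltnW n_ge2); pose i1 : 'I_n := Ordinal n_ge2.
pose H (i : 'I_n) (s : bool) := [set z : V | r < (-1) ^+ s * (z 0 i - y 0 i)].
have cH i s : connected (H i s).
  apply: convex_connected => a b; rewrite /H /= => Ha Hb z [t /=].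
  rewrite in_itv /= => /andP[t0 t1] <-; rewrite !mxE.
  have -> : (-1) ^+ s * (a 0 i + t * (b 0 i - a 0 i) - y 0 i)
    = (1 - t) * ((-1) ^+ s * (a 0 i - y 0 i)) + t * ((-1) ^+ s * (b 0 i - y 0 i)).
    by ring.
  have [->|t1'] := eqVneq t 1; first by rewrite subrr mul0r add0r mul1r.
  have t1'' : 0 < 1 - t by rewrite subr_gt0 lt_neqAle t1'.
  have : (1 - t) * r < (1 - t) * ((-1) ^+ s * (a 0 i - y 0 i)) by rewrite ltr_pM2l.
  have : t * r <= t * ((-1) ^+ s * (b 0 i - y 0 i)) by rewrite ler_wpM2l// ltW.
  by lra.
have HH i s j s' : i != j -> (H i s `&` H j s') !=set0.
  move=> ij; exists (\row_k (y 0 k + (r + 1) *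
    (if k == i then (-1) ^+ s else (-1) ^+ s'))).
  by split; rewrite /H /= !mxE ?eqxx 1?eq_sym 1?(negbTE ij) addrAC subrr add0r
    mulrCA -expr2 sqrr_sign mulr1; lra.
pose j i := if i == i0 then i1 else i0.
have ij i : i != j i by rewrite /j; have [->|] := eqVneq i i0.
pose B (p : 'I_n * bool) := H p.1 p.2 `|` (H (j p.1) false `|` H i0 false).
have -> : [set z | r < `|z - y|] = \bigcup_(p in [set: 'I_n * bool]) B p.
  apply/seteqP; split=> [z /= rz|z [[i s] _]].
    have [i] : exists i, r < `|z 0 i - y 0 i|.
      apply: contrapT => /forallNP h; move: rz; rewrite ltNge => /negP; apply.
      by apply/rV_norm_le => // i; rewrite !mxE leNgt; apply/negP; exact: h.
    case: (lerP 0 (z 0 i - y 0 i)) => [h|/ltW h].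
      by rewrite ger0_norm// => rzi; exists (i, false) => //; left;
        rewrite /H /= expr0 mul1r.
    by rewrite ler0_norm// => rzi; exists (i, true) => //; left;
      rewrite /H /= expr1 mulN1r.
  have Hsub k s' : H k s' z -> r < `|z - y|.
    rewrite /H /= => rk; rewrite ltNge; apply/negP => /(rV_norm_le _ r0)/(_ k).
    rewrite !mxE leNgt => /negP; apply; apply: lt_le_trans rk _.
    by apply: le_trans (ler_norm _) _; rewrite normrM normrX normrN1 expr1n mul1r.
  by move=> [|[]]; exact: Hsub.
apply: bigcup_connected.
  by have [z [Hz _]] := HH i0 false i1 false isT; exists z => p _; right; right.
move=> [i s] _; rewrite /B /=.
have cJ : connected (H (j i) false `|` H i0 false).
  rewrite /j; case: (i == i0); last by rewrite setUid.
  by apply: connectedU => //; exact: HH.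
apply: connectedU => //.
by have [z [Hi Hj]] := HH i s (j i) false (ij i); exists z; split=> //; left.
Qed.

Lemma card_connectivity_rV (W : set (V -> R)) :
  (forall f, W f -> connectivity_on [set: V] f) ->
  (forall f g, W f -> W g -> connectivity_on [set: V] (f \- g)) ->
  (W #<= [set: R])%card.
Proof.
have u0 : (const_mx 1 : V) != 0.
  apply/eqP => /rowP/(_ (Ordinal n_ge2)); rewrite !mxE => /eqP.
  by rewrite oner_eq0.
by apply: (@card_connectivity_fcts R V rV_outside_connected
  (@rV_bounded_compact) _ u0 _ _ (@rV_rat_dense)).
Qed.

Lemma extendable_connectivity (f : V -> R^o) : extendable_fcts R n f ->
  connectivity_on [set: V] (f : V -> R).
Proof.
move=> [F [cF fF]] Z _ cZ.
pose Z0 := [set (x, 0 : R) | x in Z].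
have cZ0 : connected Z0.
  apply: connected_continuous_connected => //.
  apply: continuous_subspaceT; apply: continuous_pair.
    by move=> x; exact: cvg_id.
  exact: cst_continuous.
have sZ0 : Z0 `<=` [set x : V * R | 0 <= x.2 <= 1].
  by move=> _ [x _ <-] /=; rewrite lexx ler01.
have -> : [set (x, f x) | x in Z] =
    (fun p : (V * R) * R => (p.1.1, p.2)) @` [set (x, F x) | x in Z0].
  apply/seteqP; split=> [_ [x Zx <-]|_ [_ [_ [x Zx <-] <-] <-]] /=.
    exists ((x, 0), F (x, 0)); first by exists (x, 0) => //; exists x.
    by rewrite /= fF.
  by exists x => //; rewrite fF.
apply: connected_continuous_connected; first exact: cF.
apply: continuous_subspaceT; apply: continuous_pair; last exact: continuous_snd.
by move=> p; apply: continuous_comp; exact: continuous_fst.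
Qed.

Lemma continuous_extendable (f : V -> R^o) : continuous_fcts R n f ->
  extendable_fcts R n f.
Proof.
move=> cf; exists (fun p => f p.1); split=> // Z _ cZ.
apply: connected_continuous_connected => //.
apply: continuous_subspaceT; apply: continuous_pair => p; first exact: cvg_id.
by apply: continuous_comp; [exact: continuous_fst|exact: cf].
Qed.

Lemma cst0_extendable : extendable_fcts R n 0.
Proof. by apply: continuous_extendable; exact: cst_continuous. Qed.

(** The difference of two elements of the subspace is again a connectivity
    function, as required for codes to separate them. *)
Lemma card_extendable_subspace (W : set (V -> R^o)) : submod_closed [in W] ->
  W `<=` extendable_fcts R n `|` [set 0] -> (W #<= [set: R])%card.
Proof.
move=> [W0 WD] WE.
have cW f : W f -> connectivity_on [set: V] (f : V -> R).
  move=> /WE[|->]; first exact: extendable_connectivity.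
  exact/extendable_connectivity/cst0_extendable.
apply: card_connectivity_rV => // f g Wf Wg; apply: cW.
have := WD (-1) g f; rewrite !inE => /(_ Wg Wf).
by rewrite scaleN1r addrC.
Qed.

End Euclidean.

(** * Hamel bases *)

Section Hamel.
Variables (R : realType) (V : lmodType R).
Implicit Types (A B W : set V) (s : seq V) (v w : V).

(** A family written with repetitions can be summed over its distinct
    members. *)
Lemma sum_count (F : V -> V) s r : uniq r -> {subset s <= r} ->
  \sum_(v <- r) F v *+ count_mem v s = \sum_(v <- s) F v.
Proof.
move=> ur; elim: s => [_|x s IH sr].
  by rewrite big_nil big1// => v _; rewrite mulr0n.
rewrite big_cons -IH; last by move=> v vs; apply: sr; rewrite in_cons vs orbT.
have xr : x \in r by apply: sr; exact: mem_head.
under eq_bigr => v _ do rewrite /= mulrnDr.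
rewrite big_split /=; congr (_ + _).
rewrite (bigD1_seq x)//= eqxx mulr1n big1 ?addr0// => v vx.
by rewrite eq_sym (negbTE vx) mulr0n.
Qed.

Lemma lin_span_submod B : submod_closed [in lin_span B].
Proof.
split; first by rewrite inE; exists [::], (fun=> 0); rewrite big_nil.
move=> k _ _ /set_mem[s [a [sB ->]]] /set_mem[t [b [tB ->]]]; rewrite inE.
pose r := undup (s ++ t).
have sr : {subset s <= r} by move=> v vs; rewrite mem_undup mem_cat vs.
have tr : {subset t <= r} by move=> v vt; rewrite mem_undup mem_cat vt orbT.
exists r, (fun v => k * a v *+ count_mem v s + b v *+ count_mem v t); split.
  by move=> v /=; rewrite mem_undup mem_cat => /orP[/sB|/tB].
under [RHS]eq_bigr => v _ do rewrite scalerDl -!scalerMnl -scalerA.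
by rewrite big_split /= !sum_count ?undup_uniq// scaler_sumr.
Qed.

Lemma lin_span_le B W : submod_closed [in W] -> B `<=` W -> lin_span B `<=` W.
Proof.
move=> [W0 WD] BW _ [s [a [+ ->]]]; elim: s => [_|v s IH sB].
  by rewrite big_nil -inE.
rewrite big_cons -inE; apply: WD; rewrite inE.
  by apply/BW/sB; exact: mem_head.
by apply: IH => w ws; apply: sB; rewrite /= in_cons ws orbT.
Qed.

Lemma lin_span_id B : B `<=` lin_span B.
Proof.
move=> v Bv; exists [:: v], (fun=> 1); split; last by rewrite big_seq1 scale1r.
by move=> w /=; rewrite inE => /eqP ->.
Qed.

Lemma lin_indep_sub A B : A `<=` B -> lin_indep B -> lin_indep A.
Proof. by move=> AB iB s a us sA; apply: iB => // v /sA/AB. Qed.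

Lemma lin_indepU1 B w : lin_indep B -> ~ lin_span B w -> lin_indep (B `|` [set w]).
Proof.
move=> iB nw s a us sB s0.
have [ws|nws] := boolP (w \in s); last first.
  apply: iB us _ s0 => v vs; have [//|/= vw] := sB v vs.
  by rewrite -vw vs in nws.
have remB : [set` rem w s] `<=` B.
  move=> v /=; rewrite mem_rem_uniq// !inE => /andP[vw vs].
  by have [//|/= ve] := sB v vs; rewrite ve eqxx in vw.
rewrite (big_rem w)//= in s0.
have aw : a w = 0.
  apply/eqP/negPn/negP => aw; apply: nw.
  exists (rem w s), (fun v => - (a w)^-1 * a v); split=> //.
  under eq_bigr => v _ do rewrite -scalerA.
  have eS : \sum_(v <- rem w s) a v *: v = - (a w *: w).
    by apply/eqP; rewrite -addr_eq0 addrC s0.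
  by rewrite -scaler_sumr eS scaleNr scalerN opprK scalerA mulVf// scale1r.
move=> v vs; have [->//|vw] := eqVneq v w.
apply: (iB (rem w s) a); [exact: rem_uniq|by []| |].
  by rewrite aw scale0r add0r in s0.
by rewrite mem_rem_uniq// !inE vw.
Qed.

(** Zorn's lemma, applied to the sets that can be added to [B0]; they form a
    family containing the empty set, so that the empty chain is bounded. *)
Lemma basis_extension W B0 : submod_closed [in W] -> B0 `<=` W -> lin_indep B0 ->
  exists B, [/\ B0 `<=` B, lin_indep B & lin_span B = W].
Proof.
move=> sW B0W iB0.
pose P := [set A | A `<=` W /\ lin_indep (B0 `|` A)].
have [|A [[AW iA] Amax]] := @Zorn_bigcup V P.
  move=> F FP Ftot; split; first by move=> v [X /FP[XW _] /XW].
  move=> s a us sF s0.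
  suff [X FX sX] : exists2 X, F X \/ X = set0 & [set` s] `<=` B0 `|` X.
    have iX : lin_indep (B0 `|` X).
      by case: FX => [/FP[]//|->]; rewrite setU0.
    exact: iX us sX s0.
  elim: s {us s0} sF => [_|v s IH sF]; first by exists set0; [right|].
  have [|X FX sX] := IH; first by move=> w ws; apply: sF; rewrite /= in_cons ws orbT.
  have [B0v|[Y FY Yv]] := sF v (mem_head _ _).
    exists X => // w /=; rewrite in_cons => /predU1P[->|ws]; first by left.
    exact: sX.
  have [XY|YX] : X `<=` Y \/ Y `<=` X.
    by case: FX => [FX|->]; [exact: Ftot|left; exact: sub0set].
  - exists Y; first by left.
    move=> w /=; rewrite in_cons => /predU1P[->|/sX[|/XY]]; by [right|left|right].
  - exists X => // w /=; rewrite in_cons => /predU1P[->|ws]; last exact: sX.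
    by right; exact: YX.
exists (B0 `|` A); split=> //; apply/seteqP; split.
  by apply: lin_span_le => // v [/B0W|/AW].
move=> w Ww; apply: contrapT => nw; apply: (Amax (A `|` [set w])).
  split; first by left.
  move=> /(_ w (or_intror erefl)) Aw; apply/nw/lin_span_id; by right.
split; first by move=> v [/AW//|->].
by rewrite setUA; exact: lin_indepU1.
Qed.

Lemma card_le_subset (T U : Type) (K : set T) (B : set U) : (K #<= B)%card ->
  exists2 B', B' `<=` B & (B' #= K)%card.
Proof.
move=> /card_leP[f]; exists ((fun k => set_val (f k)) @` [set: K]).
  by move=> _ [k _ <-]; exact: set_valP.
apply: card_eq_trans (card_setT K).
apply: inj_card_eq => k l _ _ /val_inj; apply: inj; exact: mem_setT.
Qed.

End Hamel.

(** * Successor cardinals *)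

(** Well-order [U] and take the points of [E] that have few predecessors in [E].
    The set [K] of these points is an initial segment; if it were small, the
    least point of [E] outside [K] would have few predecessors. A set [C] that is
    not small receives [K] by transfinite recursion: the values at the
    predecessors of a point never exhaust [C]. *)
Lemma card_succ_exists (T : Type) (A : set T) (U : eqType) (E : set U) :
  ~ (E #<= A)%card -> exists K : set U, card_succ A K.
Proof.
move=> nE; have [r wo] := wochoice.well_ordering_principle U.
have rmin (X : set U) : X !=set0 -> exists2 z, X z & forall x, X x -> r z x.
  move=> [x Xx]; have [|z [[zX zmin] _]] := wo (mem X).
    by exists x; exact: mem_set.
  by exists z; [exact: set_mem|move=> y Xy; apply: zmin; exact: mem_set].
have rxx x : r x x.
  by have [z -> ] := rmin [set x] (ex_intro _ x erefl); exact.
have rtot x y : r x y \/ r y x.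
  have [z [->|->] h] := rmin [set x; y] (ex_intro _ x (or_introl erefl)).
    by left; apply: h; right.
  by right; apply: h; left.
have ranti x y : r x y -> r y x -> x = y.
  move=> xy yx; have [|z [_ uz]] := wo (mem [set x; y]).
    by exists x; apply: mem_set; left.
  rewrite -(uz x); last first.
    by split; [apply: mem_set; left|move=> w /set_mem[->|->]].
  by apply: uz; split; [apply: mem_set; right|move=> w /set_mem[->|->]].
pose below x : set U := [set y | E y /\ ~ r x y].
pose K : set U := [set x | E x /\ (below x #<= A)%card].
have rtrans x y z : r x y -> r y z -> r x z.
  move=> xy yz.
  have [w] := rmin [set x; y; z] (ex_intro _ x (or_introl (or_introl erefl))).
  move=> [[->|->]|->] h.
  - by apply: h; right.
  - by have -> : x = y by apply: ranti => //; apply: h; left; left.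
  - have zy : z = y by apply: ranti => //; apply: h; left; right.
    by rewrite zy.
have belowK x : K x -> below x `<=` K.
  move=> [Ex xA] y [Ey nxy]; split=> //; apply: card_le_trans xA.
  apply: subset_card_le => z [Ez nyz]; split=> // xz; apply: nyz.
  by have [//|zy] := rtot y z; exfalso; apply: nxy; exact: rtrans zy.
have nK : ~ (K #<= A)%card.
  move=> KA; have [EK|nEK] := pselect (E `<=` K).
    by apply: nE; apply: card_le_trans KA; exact: subset_card_le.
  have /rmin[z [Ez nKz] zmin] : (E `\` K) !=set0.
    apply: contrapT => n0; apply: nEK => x Ex; apply: contrapT => nKx.
    by apply: n0; exists x.
  apply: nKz; split=> //; apply: card_le_trans KA; apply: subset_card_le.
  move=> y [Ey nzy]; apply: contrapT => nKy; apply: nzy; exact: zmin.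
exists K; split; first exact/negP.
move=> T' C /negP nC.
have [c0 Cc0] : C !=set0.
  apply/set0P/negP => /eqP C0; apply: nC; rewrite C0; exact: card_ge0.
pose lt y x := K y /\ ~ r x y.
have ltwf : well_founded lt.
  move=> x; apply: contrapT => nx.
  have [z nz zmin] := rmin [set x | ~ Acc lt x] (ex_intro _ x nx).
  apply: nz; split=> y [_ nzy]; apply: contrapT => ny; apply: nzy; exact: zmin.
pose fresh x (rec : forall y, lt y x -> T') :=
  [set c | C c /\ forall y (h : lt y x), c <> rec y h].
pose F x (rec : forall y, lt y x -> T') : T' :=
  match pselect (fresh x rec !=set0) with
  | left ex => sval (cid ex)
  | right _ => c0
  end.
pose g := Fix ltwf (fun=> T') F.
have gE x : g x = F x (fun y _ => g y).
  apply: (Fix_eq ltwf (fun=> T')) => z f h fh.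
  suff -> : f = h by [].
  by apply: functional_extensionality_dep => y; apply: funext.
have gK x : K x -> C (g x) /\ forall y, lt y x -> g x <> g y.
  move=> Kx; rewrite gE /F; case: pselect => [ex|nex].
    by have [] := svalP (cid ex).
  exfalso; apply: nC; have [_ xA] := Kx.
  have CL : C `<=` g @` [set y | lt y x].
    move=> c Cc; apply: contrapT => nc; apply: nex; exists c; split=> // y h e.
    by apply: nc; exists y.
  apply: card_le_trans (subset_card_le CL) _.
  apply: card_le_trans (card_image_le _ _) _; apply: card_le_trans xA.
  by apply: subset_card_le => y [[Ey _]].
have ginj : {in K &, injective g}.
  move=> x y /set_mem Kx /set_mem Ky exy; apply: contrapT => nxy.
  have [rxy|nrxy] := pselect (r x y).
    have nryx : ~ r y x by move=> ryx; apply: nxy; exact: ranti.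
    by have [_ /(_ x (conj Kx nryx))] := gK y Ky; rewrite exy.
  by have [_ /(_ y (conj Ky nrxy))] := gK x Kx; rewrite exy.
have /card_eqPle[_ le] := inj_card_eq ginj.
apply: card_le_trans le _; apply: subset_card_le.
by move=> _ [x /gK[Cx _] <-].
Qed.

(** Cantor's diagonal argument. *)
Lemma not_powerset_le (T : Type) : ~ ([set: set T] #<= [set: T])%card.
Proof.
move=> /card_leP[f].
pose h (A : set T) := set_val (f (SigSub (mem_set (I : [set: set T] A)))).
have hi : injective h.
  move=> A B /val_inj e; have : SigSub (mem_set (I : [set: set T] A))
      = SigSub (mem_set (I : [set: set T] B)) by apply: inj e; exact: mem_setT.
  by move=> /(congr1 set_val).
pose D := [set x | exists2 A, x = h A & ~ A x].
have nD : ~ D (h D) by move=> DhD; have [A /hi <-] := DhD; apply.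
by apply: (nD); exists D.
Qed.

(** * A closed space of continuous functions *)

Section WaveSpace.
Variables (R : realType) (n : nat) (i0 i1 : 'I_n).
Hypothesis i01 : i0 != i1.
Notation V := 'rV[R]_n.
Notation fct := (V -> R^o).
Implicit Types (f : fct) (a : int -> R) (t : R) (k : int) (x : V).

(** The function [max (0, 4 t (1 - t))], an arch over the interval [0, 1], written
    with an absolute value. *)
Definition arch t : R := 2 * (t * (1 - t)) + `|2 * (t * (1 - t))|.

Lemma arch_in t : 0 <= t -> t <= 1 -> arch t = 4 * (t * (1 - t)).
Proof. by move=> t0 t1; rewrite /arch ger0_norm ?mulr_ge0 ?subr_ge0//; ring. Qed.

Lemma arch_out t : t <= 0 \/ 1 <= t -> arch t = 0.
Proof. by move=> t01; rewrite /arch ler0_norm ?subrr//; case: t01 => ?; nra. Qed.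

Lemma arch_continuous : continuous arch.
Proof.
have c : continuous (fun t : R => 2 * (t * (1 - t))).
  move=> t; apply: cvgM; first exact: cvg_cst.
  apply: cvgM; first exact: cvg_id.
  by apply: cvgB; [exact: cvg_cst|exact: cvg_id].
by move=> t; apply: cvgD; [exact: c|apply: cvg_norm; exact: c].
Qed.

Lemma arch_shift c : continuous (fun t : R => arch (t - c)).
Proof.
have cB : continuous (fun t : R => t - c).
  by move=> t; apply: cvgB; [exact: cvg_id|exact: cvg_cst].
by move=> t; exact: (continuous_comp (cB t) (@arch_continuous _)).
Qed.

Definition wave a t : R := a (Num.floor t) * arch (t - (Num.floor t)%:~R).

(** Near [t], only the arches of two consecutive intervals matter. *)
Lemma wave_continuous a : continuous (wave a).
Proof.
move=> t; set m := Num.floor t.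
pose g s := a (m - 1) * arch (s - (m - 1)%:~R) + a m * arch (s - m%:~R).
have cg : continuous g.
  by move=> s; apply: cvgD; (apply: cvgM; first exact: cvg_cst); exact: arch_shift.
have /andP[mt tm] := floor_itv t; rewrite -/m in mt tm.
have m1 : (m - 1)%:~R = m%:~R - 1 :> R by rewrite intrB.
have p1 : (m + 1)%:~R = m%:~R + 1 :> R by rewrite intrD.
have gw s : m%:~R - 1 < s -> s < m%:~R + 1 -> wave a s = g s.
  move=> ms sm; rewrite /wave /g; have [mles|slm] := leP m%:~R s.
    rewrite (@floor_def _ s m) ?mles ?p1//.
    by rewrite (arch_out (t := s - (m - 1)%:~R)) ?mulr0 ?add0r// m1; right; lra.
  rewrite (@floor_def _ s (m - 1)) ?subrK ?slm ?m1 ?ltW//.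
  by rewrite (arch_out (t := s - m%:~R)) ?mulr0 ?addr0//; left; lra.
have nearw : \forall s \near t, g s = wave a s.
  have : \forall s \near t, m%:~R - 1 < s /\ s < m%:~R + 1.
    near=> s; split; near: s; [apply: lt_nbhsr|apply: lt_nbhsl]; rewrite -?p1//.
    by lra.
  by apply: filterS => s [? ?]; rewrite gw.
rewrite /continuous_at; have -> : wave a t = g t by rewrite gw// ?(lt_le_trans _ mt)// -?p1//; lra.
by apply: cvg_trans (cg t); apply: near_eq_cvg.
Unshelve. all: by end_near. Qed.

Definition node k (y : R) : V :=
  \row_j (if j == i0 then k%:~R + 2^-1 else if j == i1 then y else 0).

Definition hat x : R := arch (x 0 i0 - (Num.floor (x 0 i0))%:~R) * x 0 i1.

Lemma node_floor k y : Num.floor (node k y 0 i0) = k.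
Proof.
rewrite mxE eqxx; apply: floor_def; rewrite intrD; apply/andP; split; lra.
Qed.

Lemma hat_node k y : hat (node k y) = y.
Proof.
rewrite /hat node_floor !mxE eqxx (eq_sym i1) (negbTE i01) eqxx addrAC subrr add0r.
rewrite arch_in; [|lra..].
by rewrite [X in X * y](_ : _ = 1) ?mul1r//; lra.
Qed.

(** The functions [x |-> a (floor x_i0) * hat x], described by the equations that
    they satisfy at each point: this makes pointwise closedness plain. Because of
    the factor [x_i1] in [hat], only the zero function is bounded. *)
Definition waves : set fct :=
  [set f | forall x, f x = f (node (Num.floor (x 0 i0)) 1) * hat x].

Definition of_values a : fct := fun x => a (Num.floor (x 0 i0)) * hat x.

Lemma of_values_waves a : waves (of_values a).
Proof. by move=> x; rewrite /of_values node_floor hat_node mulr1. Qed.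

Lemma of_values_node a k : of_values a (node k 1) = a k.
Proof. by rewrite /of_values node_floor hat_node mulr1. Qed.

Lemma waves_submod : submod_closed [in waves].
Proof.
split; first by rewrite inE => x; rewrite mul0r.
move=> c f g /set_mem Wf /set_mem Wg; rewrite inE => x.
rewrite -[LHS]/(c * f x + g x) -[X in _ = X * _]/(c * f (node _ 1) + g (node _ 1)).
by rewrite Wf Wg; ring.
Qed.

Lemma waves_continuous : waves `<=` continuous_fcts R n.
Proof.
move=> f Wf.
have -> : f = (fun x => wave (fun k => f (node k 1)) (x 0 i0) * x 0 i1).
  by apply/funext => x; rewrite Wf /hat /wave mulrA.
move=> x; apply: (@cvgM _ _ (nbhs x)); last exact: coord_continuous.
have ci0 : {for x, continuous (fun x : V => x 0 i0)} by exact: coord_continuous.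
have cw := @wave_continuous (fun k => f (node k 1)) (x 0 i0).
exact: continuous_comp ci0 cw.
Qed.

Lemma waves_closed_p : closed_p waves.
Proof.
have -> : waves = \bigcap_(x in [set: V])
    ((fun f : {ptws V -> R} => f x - f (node (Num.floor (x 0 i0)) 1) * hat x)
      @^-1` [set 0]).
  apply/seteqP; split=> [f Wf x _ /=|f Wf x].
    by rewrite {1}Wf subrr.
  by apply/eqP; rewrite -subr_eq0; apply/eqP; exact: Wf x I.
apply: closed_bigI => x _; apply: closed_comp; last exact: closed_eq.
have ev y : continuous (fun f : {ptws V -> R} => f y : R).
  exact: (@proj_continuous V (fun=> R) y).
move=> f _.
have h1 := ev x f.
have h2 := ev (node (Num.floor (x 0 i0)) 1) f.
exact: (cvgB h1 (cvgM h2 (cvg_cst (hat x)))).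
Qed.

Lemma waves_bounded f M : waves f -> (forall x, `|f x| <= M) -> f = 0.
Proof.
move=> Wf fM; apply/funext => x; rewrite Wf.
set k := Num.floor _; suff -> : f (node k 1) = 0 by rewrite mul0r.
apply: contrapT => /eqP fk.
have f0 : 0 < `|f (node k 1)| by rewrite normr_gt0.
have := fM (node k ((`|M| + 1) / `|f (node k 1)|)).
rewrite Wf node_floor hat_node normrM [X in _ * X]ger0_norm ?divr_ge0 ?addr_ge0//.
rewrite mulrC divfK ?gt_eqF// leNgt => /negP; apply.
by apply: le_lt_trans (ler_norm M) _; rewrite ltrDl.
Qed.

(** Two elements of [W] that are uniformly close to the same function differ by a
    bounded one, hence are equal. *)
Lemma waves_sub_closed_u (W : set fct) : submod_closed [in W] -> W `<=` waves ->
  closed_u W.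
Proof.
move=> [_ WD] WW g cg.
have approx e : 0 < e -> exists2 w, W w & forall x, `|g x - w x| < e.
  move=> e0; pose B := [set h : {uniform V -> R} | forall x, `|g x - h x| < e].
  have nB : nbhs (g : {uniform V -> R}) B.
    apply/uniform_nbhs; exists [set xy : R * R | ball xy.1 e xy.2].
    split; first by rewrite -entourage_ballE; exists e.
    by move=> h gh x; have := gh x I; rewrite /= -ball_normE.
  by have [w [Ww Bw]] := cg _ nB; exists w.
have [w Ww gw] := approx 1 ltr01.
suff -> : g = w by [].
apply/funext => x; apply/eqP; rewrite -subr_eq0 -normr_le0; apply/ler_addgt0Pl => e e0.
have [w' Ww' gw'] := approx e e0.
have W0 : waves (-1 *: w' + w).
  by apply: WW; have := WD (-1) w' w; rewrite !inE => /(_ Ww' Ww).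
have /(congr1 (fun h : fct => h x)) : -1 *: w' + w = 0.
  apply: (@waves_bounded _ (1 + e)) W0 _ => y.
  rewrite -[X in `|X|]/(-1 * w' y + w y).
  have := gw y; have := gw' y; have := ler_distD (g y) (w y) (w' y).
  by rewrite (distrC (w y) (g y)) mulN1r addrC; lra.
rewrite -[LHS]/(-1 * w' x + w x) mulN1r addrC => /eqP; rewrite subr_eq0 => /eqP ->.
by rewrite addr0; exact: ltW.
Qed.

(** Sequences of powers of distinct numbers are independent, by Lagrange
    interpolation; there are continuum many of them. *)
Definition powers (r : R) (k : int) : R := if k is Posz j then r ^+ j else 0.

Lemma powers_inj : injective (fun r => of_values (powers r)).
Proof.
move=> r s /(congr1 (fun f : fct => f (node 1 1))); rewrite /= !of_values_node.
by rewrite /= !expr1.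
Qed.

Lemma powers_indep : lin_indep (range (fun r => of_values (powers r))).
Proof.
move=> s c us sB s0; pose rho f := f (node 1 1).
have pow f j : f \in s -> f (node (Posz j) 1) = rho f ^+ j.
  by move=> /sB[r _ <-]; rewrite /rho !of_values_node /= expr1.
have rho_inj f g : f \in s -> g \in s -> rho f = rho g -> f = g.
  move=> /sB[r _ <-] /sB[r' _ <-]; rewrite /rho !of_values_node /= !expr1.
  by move=> ->.
have momj j : \sum_(f <- s) c f * rho f ^+ j = 0.
  have := congr1 (fun h : fct => h (node (Posz j) 1)) s0; rewrite fct_sumE.
  apply: etrans; rewrite big_seq [RHS]big_seq.
  by apply: eq_bigr => f fs; rewrite -pow.
have mom (p : {poly R}) : \sum_(f <- s) c f * p.[rho f] = 0.
  under eq_bigr => f _ do rewrite horner_coef mulr_sumr.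
  rewrite exchange_big big1//= => j _.
  under eq_bigr => f _ do rewrite mulrCA.
  by rewrite -mulr_sumr momj mulr0.
(* The polynomial vanishing at all the nodes but the one of [f]. *)
move=> f fs; have := mom (\prod_(g <- rem f s) ('X - (rho g)%:P)).
rewrite (big_rem f)//= [X in _ + X]big1_seq => [|g /= gs]; last first.
  rewrite (big_rem g)//= hornerM hornerXsubC subrr mul0r mulr0//.
rewrite addr0 => /eqP; rewrite mulf_eq0 => /orP[/eqP//|].
rewrite horner_prod prodf_seq_eq0 => /hasP[g].
rewrite mem_rem_uniq// !inE hornerXsubC /= subr_eq0 => /andP[gf gs] /eqP e.
by move: gf; rewrite (rho_inj _ _ fs gs e) eqxx.
Qed.

End WaveSpace.

(** * Lineability and spaceability *)

Section Dimensions.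
Variables (R : realType) (n : nat).
Hypothesis n_ge2 : (2 <= n)%N.
Notation fct := ('rV[R]_n -> R^o).
Local Notation Ext := (extendable_fcts R n).

Lemma subspace_dim_le (Q : set fct -> Prop) (T : Type) (K : set T) :
  contains_subspace Q Ext K -> (K #<= [set: R])%card.
Proof.
move=> [W [sW _ [B [_ BW BK]] WE]].
have /card_eqPle[_ KB] := BK; apply: card_le_trans KB _.
apply: card_le_trans (card_extendable_subspace n_ge2 sW WE).
by apply: subset_card_le; rewrite -BW; exact: lin_span_id.
Qed.

Let i0 : 'I_n := Ordinal (ltnW n_ge2).
Let i1 : 'I_n := Ordinal n_ge2.
Let W := waves (R := R) i0 i1.

Lemma waves_extendable : W `<=` Ext.
Proof. by move=> f /waves_continuous; exact: continuous_extendable. Qed.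

(** At least the continuum by the independent family of powers, at most the
    continuum by the bound on subspaces of extendable functions. *)
Lemma waves_basis : exists B : set fct,
  [/\ lin_indep B, lin_span B = W & (B #= [set: R])%card].
Proof.
have i01 : i0 != i1 by [].
have [|//||B [B0B iB BW]] := @basis_extension R _ W
    (range (fun r => of_values (R := R) i0 i1 (powers r))).
- exact: waves_submod.
- by move=> _ [r _ <-]; exact: of_values_waves.
- exact: powers_indep.
exists B; split=> //; apply/card_eqPle; split.
  apply: (@subspace_dim_le (fun=> True)); exists W; split=> //.
  - exact: waves_submod.
  - by exists B.
  - by move=> f /waves_extendable; left.
apply: card_le_trans (subset_card_le B0B).
by have /card_eqPle[_] := inj_card_eq (in2W (powers_inj (R := R) i01) : {in [set: R] &, _}).
Qed.

(** Parts of a basis of the waves span subspaces of all smaller dimensions, and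
    every subspace of the waves is uniformly closed. *)
Lemma spaceable_u_le (T : Type) (K : set T) : (K #<= [set: R])%card ->
  spaceable_u Ext K.
Proof.
move=> KR; have [B [iB BW /card_eqPle[_ RB]]] := waves_basis.
have [B' B'B B'K] := card_le_subset (card_le_trans KR RB).
have B'W : lin_span B' `<=` W.
  apply: lin_span_le; first exact: waves_submod.
  by rewrite -BW; apply: subset_trans B'B _; exact: lin_span_id.
exists (lin_span B'); split.
- exact: lin_span_submod.
- by apply: (@waves_sub_closed_u R n i0 i1) => //; exact: lin_span_submod.
- by exists B'; split=> //; exact: lin_indep_sub iB.
- by move=> f /B'W/waves_extendable; left.
Qed.

Lemma lineable_le (T : Type) (K : set T) : (K #<= [set: R])%card -> lineable Ext K.
Proof. by move=> /spaceable_u_le[X [sX _ dX XE]]; exists X; split. Qed.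

Lemma spaceable_p_waves (M : set fct) (B : set fct) : W `<=` M ->
  lin_indep B -> lin_span B = W -> forall T (K : set T), (B #= K)%card ->
  spaceable_p M K.
Proof.
move=> WM iB BW T K BK; exists W; split.
- exact: waves_submod.
- exact: waves_closed_p.
- by exists B.
- by move=> f /WM; left.
Qed.

End Dimensions.

Unset Implicit Arguments.

Theorem theorem4p2 (R : realType) (n : nat) (n_ge2 : (2 <= n)%N) :
  exists cplus : set (set R),
    [/\ card_succ [set: R] cplus,
        [/\ is_Lp (extendable_fcts R n) cplus,
            is_Lu (extendable_fcts R n) cplus
          & is_L (extendable_fcts R n) cplus]
      & [/\ spaceable_p (continuous_fcts R n) [set: R],
            spaceable_p (extendable_fcts R n) [set: R],
            ~ lineable (continuous_fcts R n) cplus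
          & ~ lineable (extendable_fcts R n) cplus]].
Proof.
have [cplus [/negP ncR minc]] := card_succ_exists (@not_powerset_le R).
have [B [iB BW BR]] := @waves_basis R n n_ge2.
have WE := @waves_extendable R n n_ge2.
have minimal T (K : set T) : ~ ~~ ~~ (K #<= [set: R])%card -> (cplus #<= K)%card.
  by move=> nK; apply: minc; apply/negP => KR; apply: nK; rewrite negbK.
exists cplus; split; first by split=> //; exact/negP.
  split; split.
  - move=> [D [cD /subspace_dim_le DR]]; apply: ncR.
    by apply: card_le_trans cD _; exact: DR.
  - move=> T K nK; apply: minimal; rewrite negbK => KR; apply: nK.
    exists B; split; last exact: (spaceable_p_waves WE iB BW).
    by have /card_eqPle[_] := BR; exact: card_le_trans.
  - by move=> /subspace_dim_le cR; apply: ncR; exact: cR.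
  - by move=> T K nK; apply: minimal; rewrite negbK => KR; apply: nK; exact: spaceable_u_le.
  - by move=> /subspace_dim_le cR; apply: ncR; exact: cR.
  - by move=> T K nK; apply: minimal; rewrite negbK => KR; apply: nK; exact: lineable_le.
have nE : ~ lineable (extendable_fcts R n) cplus.
  by move=> /subspace_dim_le cR; apply: ncR; exact: cR.
split=> //.
- by apply: (spaceable_p_waves _ iB BW) BR; exact: waves_continuous.
- exact: (spaceable_p_waves WE iB BW) BR.
- move=> [X [sX QX dX XC]]; apply: nE; exists X; split=> // f /XC[cf|f0].
    by left; exact: continuous_extendable.
  by right.
Qed.
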